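(* Let $A$ be a finite-dimensional commutative Frobenius algebra over a field $K$ with associated 2D TQFT $(A,\eta,\{\Omega_{g,n}\})$. The twisted generalized Catalan numbers satisfy, for all $g\ge0$, $n\ge1$, positive integers $\mu_1,\dots,\mu_n$ and $v_1,\dots,v_n\in A$, $$\mathcal{C}_{g,n}(\mu_1,\dots,\mu_n;v_1,\dots,v_n)=\sum_{j=2}^n\mu_j\,\mathcal{C}_{g,n-1}(\mu_1+\mu_j-2,\mu_2,\dots,\widehat{\mu_j},\dots,\mu_n;\,v_1\cdot v_j,v_2,\dots,\widehat{v_j},\dots,v_n)$$ $$+\sum_{\alpha+\beta=\mu_1-2}\mathcal{C}_{g-1,n+1}(\alpha,\beta,\mu_2,\dots,\mu_n;\,\delta(v_1),v_2,\dots,v_n)$$ $$+\sum_{\alpha+\beta=\mu_1-2}\ \sum_{\substack{g_1+g_2=g\\ I\sqcup J=\{2,\dots,n\}}}\delta^*\big(\mathcal{C}_{g_1,|I|+1}(\alpha,\mu_I;-,v_I),\ \mathcal{C}_{g_2,|J|+1}(\beta,\mu_J;-,v_J)\big)(v_1).$$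
   Context: **Frobenius algebra.** $A$ has unit $1$, product $u\cdot v$, nondegenerate symmetric bilinear form $\eta$ with $\eta(u\cdot v,w)=\eta(u,v\cdot w)$, counit $\epsilon(u)=\eta(1,u)$ and three-point function $\phi(u,v,w)=\eta(u\cdot v,w)$. For a basis $e_1,\dots,e_s$ put $\eta_{ij}=\eta(e_i,e_j)$ and $(\eta^{ij})=(\eta_{ij})^{-1}$. The coproduct is $\delta(v)=\sum_{i,j,a,b}\phi(v,e_i,e_j)\eta^{ia}\eta^{jb}e_a\otimes e_b$; the Euler element is $\mathbf{e}=m(\delta(1))$, with $m$ the product map. The associated 2D TQFT is given by $\Omega_{g,n}(v_1,\dots,v_n)=\epsilon(v_1\cdots v_n\cdot\mathbf{e}^g)$; in particular $\Omega_{0,1}=\epsilon$, $\Omega_{0,2}=\eta$. **Catalan numbers.** A cell graph of type $(g,n)$ is the 1-skeleton of a cell decomposition of a closed connected oriented surface of genus $g$, with $n$ labeled vertices (0-cells). $D_{g,n}(\mu_1,\dots,\mu_n)=\sum_\gamma1/|\mathrm{Aut}(\gamma)|$, summed over isomorphism classes of connected cell graphs of type $(g,n)$ whose $i$-th vertex has degree (number of incident half-edges) $\mu_i$; automorphisms fix each vertex. The generalized Catalan number is $C_{g,n}(\mu_1,\dots,\mu_n)=\mu_1\cdots\mu_n D_{g,n}(\mu_1,\dots,\mu_n)$; it is the number of arrowed cell graphs, i.e. such graphs with an arrow placed on one incident half-edge at each vertex. By convention $C_{0,1}(0)=1$ (the single vertex without edges), and $C_{g,n}(\mu)=0$ whenever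 some $\mu_i=0$ and $(g,n)\ne(0,1)$; also $C_{g,n}=0$ for $g<0$. **Twisted Catalan numbers.** $\mathcal{C}_{g,n}(\mu_1,\dots,\mu_n;v_1,\dots,v_n)=C_{g,n}(\mu_1,\dots,\mu_n)\,\Omega_{g,n}(v_1,\dots,v_n)$ is the number of arrowed cell graphs whose vertices are decorated by $v_1,\dots,v_n$. **Notation.** $\alpha,\beta\ge0$ are integers; $\mu_I=(\mu_i)_{i\in I}$, $v_I=(v_i)_{i\in I}$; hats denote omission. $\mathcal{C}_{g-1,n+1}(\dots;\delta(v_1),\dots)$ means that the two tensor factors of $\delta(v_1)$ are inserted in the first two $A$-slots (extended linearly). For linear functionals $f,h$ on $A$, $\delta^*(f,h)(v)=\sum_{k,\ell,a,b}\phi(v,e_k,e_\ell)\eta^{ka}\eta^{\ell b}f(e_a)h(e_b)$; ''$-$'' marks the open $A$-slot. The last sum runs over all $g_1,g_2\ge0$ and all ordered partitions $I\sqcup J$, including $(0,1)$ terms. *)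

(* Defs.v *)
From HB Require Import structures.
From mathcomp Require Import all_boot all_order all_algebra all_fingroup all_field.

Set Implicit Arguments.
Unset Strict Implicit.
Unset Printing Implicit Defensive.

Import GRing.Theory.
Local Open Scope ring_scope.

(* A cell decomposition of a closed oriented surface is encoded, as usual, by
   its 1-skeleton with the cyclic order of the half-edges at each vertex:
   rotation G h is the half-edge following h around its vertex, opposite G h
   is the other half of the edge containing h, and vertex G h is the labelled
   vertex carrying h (vertices 1, ..., n are the elements of 'I_n). *)
Definition cell_data (H : finType) (n : nat) : Type :=
  ({perm H} * {perm H} * {ffun H -> 'I_n})%type.

Definition rotation (H : finType) (n : nat) (G : cell_data H n) : {perm H} :=
  G.1.1.
Definition opposite (H : finType) (n : nat) (G : cell_data H n) : {perm H} :=
  G.1.2.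
Definition vertex (H : finType) (n : nat) (G : cell_data H n) : H -> 'I_n :=
  G.2.

Definition adjacent (H : finType) (n : nat) (G : cell_data H n) : rel 'I_n :=
  fun i j => [exists h, (vertex G h == i) && (vertex G (opposite G h) == j)].

Definition degree (H : finType) (n : nat) (G : cell_data H n) (i : 'I_n) : nat :=
  #|[set h | vertex G h == i]|.

(* The boundary walks of the 2-cells are the orbits of this permutation. *)
Definition face_perm (H : finType) (n : nat) (G : cell_data H n) : {perm H} :=
  (opposite G * rotation G)%g.

(* The last clause is V - E + F = 2 - 2g.  The graph consisting of a single
   vertex, whose unique face has no boundary half-edge, is not covered by this
   count of faces; it is dealt with in catalan below. *)
Definition is_cell_graph (H : finType) (n : nat) (g : nat) (G : cell_data H n) :
    bool :=
  [&& [forall h, (opposite G h != h) && (opposite G (opposite G h) == h)],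
      [forall h, forall h',
         (vertex G h == vertex G h') == (h' \in porbit (rotation G) h)],
      [forall i, forall j, connect (adjacent G) i j]
    & (n + #|porbits (face_perm G)| + 2 * g == #|porbits (opposite G)| + 2)%N].

Definition is_cell_iso (H : finType) (n : nat) (G G' : cell_data H n)
    (f : {perm H}) : bool :=
  [forall h, [&& f (rotation G h) == rotation G' (f h),
                 f (opposite G h) == opposite G' (f h)
               & vertex G h == vertex G' (f h)]].

Definition cell_isog (H : finType) (n : nat) : rel (cell_data H n) :=
  fun G G' => [exists f, is_cell_iso G G' f].

Definition cell_aut (H : finType) (n : nat) (G : cell_data H n) : {set {perm H}} :=
  [set f | is_cell_iso G G f].

(* A graph with vertex degrees mu has sumn mu half-edges, so that every
   isomorphism class is represented on the half-edge set 'I_(sumn mu). *)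
Definition cell_graphs (g : nat) (mu : seq nat) :
    {set cell_data 'I_(sumn mu) (size mu)} :=
  [set G | is_cell_graph g G
         & [forall i : 'I_(size mu), degree G i == nth 0%N mu i]].

Definition cell_classes (g : nat) (mu : seq nat) :
    {set {set cell_data 'I_(sumn mu) (size mu)}} :=
  equivalence_partition (@cell_isog 'I_(sumn mu) (size mu)) (cell_graphs g mu).

(* D_{g,n}(mu) with n = size mu; a transversal contains one representative of
   each isomorphism class. *)
Definition cell_count (g : nat) (mu : seq nat) : rat :=
  \sum_(G in transversal (cell_classes g mu) (cell_graphs g mu))
     (#|cell_aut G|%:R)^-1.

(* C_{g,n}(mu) with n = size mu. *)
Definition catalan (g : int) (mu : seq nat) : rat :=
  match g with
  | Posz g0 =>
      if (g0 == 0%N) && (mu == [:: 0%N]) then 1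
      else if 0%N \in mu then 0
      else (\prod_(m <- mu) m)%N%:R * cell_count g0 mu
  | Negz _ => 0
  end.

Record frobenius_form (K : fieldType) (A : falgType K) := FrobeniusForm {
  form :> {biscalar A};
  form_sym : forall u v : A, form u v = form v u;
  form_nondegenerate : forall u : A, (forall v : A, form u v = 0) -> u = 0;
  form_mul : forall u v w : A, form (u * v) w = form u (v * w)
}.

Definition counit (K : fieldType) (A : falgType K) (eta : frobenius_form A)
    (u : A) : K :=
  eta 1 u.

Definition three_point (K : fieldType) (A : falgType K) (eta : frobenius_form A)
    (u v w : A) : K :=
  eta (u * v) w.

(* The matrix (eta^{ij}) relative to the basis e. *)
Definition inv_gram (K : fieldType) (A : falgType K) (eta : frobenius_form A)
    (s : nat) (e : s.-tuple A) : 'M[K]_s :=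
  invmx (\matrix_(i, j) eta e`_i e`_j).

(* The element of A (x) A with coordinates t a b in the basis e_a (x) e_b is
   represented by the matrix t. *)
Definition coproduct (K : fieldType) (A : falgType K) (eta : frobenius_form A)
    (s : nat) (e : s.-tuple A) (v : A) : 'M[K]_s :=
  \matrix_(a, b) \sum_(i < s) \sum_(j < s)
     three_point eta v e`_i e`_j * inv_gram eta e i a * inv_gram eta e j b.

(* The linear map on A (x) A induced by the bilinear map F. *)
Definition tensor_lift (K : fieldType) (A : falgType K) (W : lmodType K)
    (s : nat) (e : s.-tuple A) (F : A -> A -> W) (t : 'M[K]_s) : W :=
  \sum_(a < s) \sum_(b < s) t a b *: F e`_a e`_b.

Definition euler (K : fieldType) (A : falgType K) (eta : frobenius_form A)
    (s : nat) (e : s.-tuple A) : A :=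
  tensor_lift e (fun u v : A => u * v) (coproduct eta e 1).

Definition codual (K : fieldType) (A : falgType K) (eta : frobenius_form A)
    (s : nat) (e : s.-tuple A) (f h : A -> K) (v : A) : K :=
  \sum_(k < s) \sum_(l < s) \sum_(a < s) \sum_(b < s)
     three_point eta v e`_k e`_l * inv_gram eta e k a * inv_gram eta e l b
     * f e`_a * h e`_b.

Definition tqft (K : fieldType) (A : falgType K) (eta : frobenius_form A)
    (s : nat) (e : s.-tuple A) (g : nat) (v : seq A) : K :=
  counit eta ((\prod_(x <- v) x) * euler eta e ^+ g).

(* catalan takes integral values, hence ratr is its image under Z -> K. *)
Definition twisted_catalan (K : fieldType) (A : falgType K)
    (eta : frobenius_form A) (s : nat) (e : s.-tuple A)
    (g : int) (mu : seq nat) (v : seq A) : K :=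
  match g with
  | Posz g0 => ratr (catalan g mu) * tqft eta e g0 v
  | Negz _ => 0
  end.

(* Main.v *)
Require Import Defs.
From HB Require Import structures.
From mathcomp Require Import all_boot all_order all_algebra all_fingroup all_field.
From mathcomp Require Import zify ring.

(** Every term of the identity is an integer times the same element of K, and
    the integers satisfy the recursion for the untwisted Catalan numbers.

    On the side of the algebra, the product of the two factors of delta(v) is v
    times the Euler element ([mul_coproductE]), and delta^* of the functionals
    counit(- p) and counit(- q) is counit(- p q) ([codual_counit]). All the terms
    thus carry the factor counit(v_1 ... v_n euler^g). The numbers being natural,
    an identity between rationals gives an identity in a field of any
    characteristic.

    For the combinatorics, an arrow at every vertex kills the automorphisms:
    arrowed cell graphs with given degrees are the matchings o of the half-edges
    for one fixed rotation r, subject to connectedness and to Euler's formula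
    ([catalanE], by orbit-stabiliser and double counting). Let x be the arrowed
    half-edge of the first vertex, y = o x, and t the transposition of x and y.
    Then o = t o' where o' fixes x and y and commutes with t, and the face
    permutation o r is o' (t r). Hence the edge is removed by replacing r by t r,
    with x and y kept as marks without edge, and the faces do not change at all.
    The marks also take care of vertices of degree 0, which become cycles made of
    marks only.

    If x and y lie on different cycles of r, then t joins these cycles and the
    edge is contracted ([edge_removed_maps_merge]). If they lie on the same one,
    then t splits it. The rest is either connected, of genus one less
    ([edge_removed_connected]), or it falls into two connected parts, whose genera
    add up ([edge_removed_disconnected]). That these genera exist and are
    nonnegative is Euler's formula for connected graphs ([euler_formula]), proved
    by adding the edges one at a time. Sorting the positions of y gives the
    recursion ([catalan_nat_rec]). *)

Set Implicit Arguments.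
Unset Strict Implicit.
Unset Printing Implicit Defensive.


(** * Double counting *)

(** Double counting of the pairs related by R. Every bijection and every fibre
    count between finite sets below is read off from it, which avoids writing
    inverse maps. *)
Lemma double_count (S T : finType) (A : {set S}) (B : {set T})
    (R : S -> T -> bool) (p q : nat) :
  (forall a, a \in A -> #|[set b in B | R a b]| = p) ->
  (forall b, b \in B -> #|[set a in A | R a b]| = q) ->
  #|A| * p = #|B| * q.
Proof.
move=> hA hB; rewrite -!sum_nat_const.
rewrite (eq_bigr (fun a => \sum_(b in B | R a b) 1)); last first.
  by move=> a /hA <-; rewrite -sum1dep_card.
rewrite (exchange_big_dep (mem B)) /=; last by move=> a b _ /andP[].
apply: eq_bigr => b /[dup] /hB <- bB; rewrite sum1dep_card; apply: eq_card => a;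
by rewrite !inE bB.
Qed.

Lemma card_indexed_union (S I : finType) (P : {set S}) (J : pred I)
    (Q : I -> {set S}) :
  (forall i x, J i -> x \in Q i -> x \in P) ->
  (forall x, x \in P -> #|[set i | J i & x \in Q i]| = 1) ->
  #|P| = \sum_(i | J i) #|Q i|.
Proof.
move=> QP hP; rewrite -sum1_card.
rewrite (eq_bigr (fun x => \sum_(i | J i && (x \in Q i)) 1)); last first.
  by move=> x /hP h; rewrite sum1dep_card h.
rewrite (exchange_big_dep J) /=; last by move=> x i _ /andP[].
apply: eq_bigr => i Ji; rewrite -sum1_card; apply: eq_bigl => x.
by rewrite Ji /=; apply: andb_idl; apply: QP.
Qed.

Lemma card_imset_ker (S T U : finType) (f : S -> T) (h : S -> U) (A : {set S}) :
  {in A &, forall x y, (f x == f y) = (h x == h y)} -> #|f @: A| = #|h @: A|.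
Proof.
move=> fh; rewrite -[LHS]muln1 -[RHS]muln1.
apply: (@double_count _ _ _ _ (fun u w => [exists x in A, (f x == u) && (h x == w)])).
  move=> _ /imsetP[x xA ->]; apply/eqP/cards1P; exists (h x).
  apply/setP=> w; rewrite !inE; apply/andP/eqP => [[_ /exists_inP[y yA]]|->].
    by rewrite fh // => /andP[/eqP<- /eqP].
  by rewrite imset_f //; split=> //; apply/exists_inP; exists x; rewrite ?eqxx.
move=> _ /imsetP[x xA ->]; apply/eqP/cards1P; exists (f x).
apply/setP=> w; rewrite !inE; apply/andP/eqP => [[_ /exists_inP[y yA]]|->].
  by rewrite -fh // => /andP[/eqP<- /eqP].
by rewrite imset_f //; split=> //; apply/exists_inP; exists x; rewrite ?eqxx.
Qed.

(** * Stable sets and orbit counts *)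

Definition stable (H : finType) (s : {perm H}) (Y : {set H}) : bool :=
  [forall y, (s y \in Y) == (y \in Y)].

Definition norb (H : finType) (s : {perm H}) (X : {set H}) : nat :=
  #|porbit s @: X|.

Lemma stableP (H : finType) (s : {perm H}) (Y : {set H}) :
  reflect (forall y, (s y \in Y) = (y \in Y)) (stable s Y).
Proof. exact: 'forall_eqP. Qed.

(** Y being finite, s cannot map it onto a proper subset of itself. *)
Lemma stable_sub (H : finType) (s : {perm H}) (Y : {set H}) :
  {in Y, forall y, s y \in Y} -> stable s Y.
Proof.
move=> sY; apply/stableP => y.
have : s @: Y \subset Y by apply/subsetP => _ /imsetP[z /sY zY ->].
move=> sub; have /eqP : s @: Y == Y.
  by rewrite eqEcard sub /= card_imset //; apply: perm_inj.
by move=> {1}<-; rewrite mem_imset //; apply: perm_inj.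
Qed.

Lemma stableT (H : finType) (s : {perm H}) : stable s setT.
Proof. by apply/stableP => y; rewrite !inE. Qed.

Lemma stableI (H : finType) (s : {perm H}) (Y Z : {set H}) :
  stable s Y -> stable s Z -> stable s (Y :&: Z).
Proof. by move=> /stableP hY /stableP hZ; apply/stableP => y; rewrite !inE hY hZ. Qed.

Lemma stableU (H : finType) (s : {perm H}) (Y Z : {set H}) :
  stable s Y -> stable s Z -> stable s (Y :|: Z).
Proof. by move=> /stableP hY /stableP hZ; apply/stableP => y; rewrite !inE hY hZ. Qed.

Lemma stableD (H : finType) (s : {perm H}) (Y Z : {set H}) :
  stable s Y -> stable s Z -> stable s (Y :\: Z).
Proof. by move=> /stableP hY /stableP hZ; apply/stableP => y; rewrite !inE hY hZ. Qed.

Lemma stableM (H : finType) (s t : {perm H}) (Y : {set H}) :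
  stable s Y -> stable t Y -> stable (s * t)%g Y.
Proof. by move=> /stableP hs /stableP ht; apply/stableP => y; rewrite permM ht hs. Qed.

Lemma stable_mulKl (H : finType) (s t : {perm H}) (Y : {set H}) :
  stable s Y -> stable (s * t)%g Y = stable t Y.
Proof.
move=> hs; apply/idP/idP => [|ht]; last exact: stableM.
move=> /stableP hst; apply/stableP => y.
by rewrite -(permKV s y) -permM hst permKV; move/stableP: hs => <-; rewrite permKV.
Qed.

Lemma stable_tperm (H : finType) (x y : H) (Y : {set H}) :
  stable (tperm x y) Y = ((x \in Y) == (y \in Y)).
Proof.
apply/stableP/eqP => [/(_ x)|xy z]; first by rewrite tpermL.
by case: tpermP => // ->.
Qed.

Lemma porbit_stable (H : finType) (s : {perm H}) (Y : {set H}) (x y : H) :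
  stable s Y -> y \in porbit s x -> (y \in Y) = (x \in Y).
Proof.
move=> /stableP sY /porbitP[i ->]; rewrite permX.
by elim: i => //= i IH; rewrite sY.
Qed.

Lemma stable_porbit (H : finType) (s : {perm H}) (x : H) : stable s (porbit s x).
Proof.
by apply/stableP => y; rewrite -!eq_porbit_mem -(porbit_perm s 1 y) expg1.
Qed.

Lemma porbit_sub (H : finType) (s : {perm H}) (Y : {set H}) (x : H) :
  stable s Y -> x \in Y -> porbit s x \subset Y.
Proof. by move=> sY xY; apply/subsetP => y /(porbit_stable sY) ->. Qed.

Lemma porbit_agree (H : finType) (s t : {perm H}) (Y : {set H}) :
  stable s Y -> {in Y, s =1 t} -> {in Y, forall x, porbit s x = porbit t x}.
Proof.
move=> sY st x xY.
have it i : (s ^+ i)%g x = (t ^+ i)%g x.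
  rewrite !permX; elim: i => //= i <-; rewrite st //.
  by rewrite -permX (porbit_stable sY (mem_porbit s i x)).
by apply/setP=> y; apply/porbitP/porbitP => -[i ->]; exists i; rewrite it.
Qed.

Lemma norb_agree (H : finType) (s t : {perm H}) (Y : {set H}) :
  stable s Y -> {in Y, s =1 t} -> norb s Y = norb t Y.
Proof. by move=> sY st; rewrite /norb (eq_in_imset (porbit_agree sY st)). Qed.

Lemma norb_split (H : finType) (s : {perm H}) (X Y : {set H}) :
  stable s Y -> Y \subset X -> norb s X = norb s Y + norb s (X :\: Y).
Proof.
move=> sY YX; rewrite /norb -{1}(setID X Y) (setIidPr YX) imsetU cardsU.
suff -> : porbit s @: Y :&: porbit s @: (X :\: Y) = set0 by rewrite cards0 subn0.
apply/setP => C; rewrite !inE; apply/negP => /andP[/imsetP[x xY ->]].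
case/imsetP => y; rewrite inE => /andP[yY _] /eqP; rewrite eq_porbit_mem => xy.
by rewrite -(porbit_stable sY xy) xY in yY.
Qed.

Lemma norbT (H : finType) (s : {perm H}) : norb s setT = #|porbits s|.
Proof.
by rewrite /norb /porbits; apply: eq_card => C; apply/imsetP/imsetP => -[x _ ->]; exists x.
Qed.

(** Multiplying by a transposition splits the cycle through x and y, or joins
    the two cycles through them. Outside X nothing changes, so the count for all
    the cycles localises to X. *)
Lemma norb_tperm (H : finType) (s : {perm H}) (X : {set H}) (x y : H) :
    stable s X -> x \in X -> y \in X -> x != y ->
  norb (tperm x y * s)%g X + (x \notin porbit s y).*2 = norb s X + 1.
Proof.
move=> sX xX yX xy; have := porbits_mul_tperm s x y; rewrite /= xy.
have stX : stable (tperm x y) X by rewrite stable_tperm xX yX.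
have sXC Z : stable Z X -> stable Z (setT :\: X) by apply/stableD/stableT.
rewrite -!norbT !(@norb_split _ _ setT X) ?subsetT //; last exact: stableM.
have -> : norb (tperm x y * s)%g (setT :\: X) = norb s (setT :\: X).
  apply: norb_agree => [|z]; first by apply/sXC/stableM.
  rewrite !inE andbT => zX; rewrite permM tpermD //; apply: contraNneq zX => <- //.
lia.
Qed.

Lemma porbit_tperm_merge (H : finType) (s : {perm H}) (x y : H) :
  x != y -> (x \in porbit (tperm x y * s)%g y) = (x \notin porbit s y).
Proof.
move=> xy; have := porbits_mul_tperm s x y; have := porbits_mul_tperm (tperm x y * s)%g x y.
by rewrite /= mulgA tperm2 mul1g xy; do 2![case: (_ \in _)] => /=; lia.
Qed.

(** * Matchings and maps *)

(** An edge is a pair of points exchanged by o; the points outside D are marks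
    that belong to no edge. *)
Definition matching (H : finType) (D : {set H}) (o : {perm H}) : bool :=
  [forall x, (o (o x) == x) && ((o x != x) == (x \in D))].

Definition transitive_on (H : finType) (X : {set H}) (r o : {perm H}) : bool :=
  [forall Y : {set H},
     [&& Y \subset X, Y != set0, stable r Y & stable o Y] ==> (Y == X)].

(** The graphs with rotation r on X whose half-edges are the points of D. The
    last clause is twice the equation V - E + F = 2 - 2g, with E = #|D| / 2. The
    marks, that is the points of X outside D, count for the cycles but not for the
    degrees: a vertex of degree 0 is a cycle made of marks, and it has a face of
    its own. *)
Definition maps (H : finType) (X : {set H}) (r : {perm H}) (D : {set H})
    (g : nat) : {set {perm H}} :=
  [set o | [&& matching D o, transitive_on X r o
             & 2 * norb r X + 2 * norb (o * r)%g X + 4 * g == #|D| + 4]].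

Lemma matchingP (H : finType) (D : {set H}) (o : {perm H}) :
  reflect ((forall x, o (o x) = x) /\ (forall x, (o x != x) = (x \in D)))
          (matching D o).
Proof.
apply: (iffP forallP) => [h|[h1 h2] x]; last by rewrite h1 h2 !eqxx.
by split=> x; have /andP[/eqP ? /eqP ?] := h x.
Qed.

Lemma transitiveP (H : finType) (X : {set H}) (r o : {perm H}) :
  reflect (forall Y : {set H}, Y \subset X -> Y != set0 -> stable r Y ->
             stable o Y -> Y = X)
          (transitive_on X r o).
Proof.
apply: (iffP forallP) => [h Y YX Y0 rY oY|h Y].
  by apply/eqP; move/implyP: (h Y); apply; rewrite YX Y0 rY oY.
by apply/implyP => /and4P[*]; apply/eqP/h.
Qed.

Lemma matching_invol (H : finType) (D : {set H}) (o : {perm H}) x :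
  matching D o -> o (o x) = x.
Proof. by case/matchingP. Qed.

Lemma matching_fix (H : finType) (D : {set H}) (o : {perm H}) x :
  matching D o -> x \notin D -> o x = x.
Proof. by case/matchingP => _ h; rewrite -h negbK => /eqP. Qed.

Lemma matching_neq (H : finType) (D : {set H}) (o : {perm H}) x :
  matching D o -> x \in D -> o x != x.
Proof. by case/matchingP => _ ->. Qed.

Lemma matching_stable (H : finType) (D X : {set H}) (o : {perm H}) :
  matching D o -> D \subset X -> stable o X.
Proof.
move=> oD DX; apply: stable_sub => x xX; have [xD|/(matching_fix oD) -> //] := boolP (x \in D).
apply: (subsetP DX); case/matchingP: oD => oK oD.
by rewrite -oD oK eq_sym oD.
Qed.

Lemma matching_mem (H : finType) (D : {set H}) (o : {perm H}) x :
  matching D o -> (o x \in D) = (x \in D).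
Proof. by move=> oD; have /stableP-> := matching_stable oD (subxx D). Qed.

Lemma matching_add (H : finType) (D : {set H}) (o : {perm H}) (x y : H) :
    matching D o -> x \notin D -> y \notin D -> x != y ->
  matching (x |: (y |: D)) (tperm x y * o)%g.
Proof.
move=> oD xD yD xy; have ox := matching_fix oD xD; have oy := matching_fix oD yD.
case/matchingP: (oD) => oK oN.
have oxy z : z != x -> z != y -> (o z != x) && (o z != y).
  by move=> zx zy; rewrite -{1}ox -{1}oy !(inj_eq perm_inj) zx zy.
apply/matchingP; split=> z; rewrite !permM; case: (tpermP x y z) => [->|->|/eqP zx /eqP zy].
- by rewrite oy tpermR ox.
- by rewrite ox tpermL oy.
- by case/andP: (oxy z zx zy) => ? ?; rewrite tpermD 1?eq_sym // oK.
- by rewrite oy !inE eqxx eq_sym xy.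
- by rewrite ox !inE eqxx xy orbT.
by rewrite oN !inE (negPf zx) (negPf zy).
Qed.

Lemma matching_remove (H : finType) (D : {set H}) (o : {perm H}) (x : H) :
    matching D o -> x \in D ->
  matching (D :\ x :\ o x) (tperm x (o x) * o)%g.
Proof.
move=> oD xD; have oxx := matching_neq oD xD.
case/matchingP: (oD) => oK oN.
apply/matchingP; split=> z; rewrite !permM; case: (tpermP x (o x) z) => [->|->|/eqP zx /eqP zy].
- by rewrite oK tpermL oK.
- by rewrite tpermR.
- rewrite tpermD ?oK // 1?eq_sym; first by rewrite -(inj_eq (@perm_inj _ o)) oK.
  by rewrite (inj_eq perm_inj).
- by rewrite oK eqxx !inE eqxx andbF.
- by rewrite !inE eqxx.
by rewrite oN !inE zx zy.
Qed.

Lemma card_matching_remove (H : finType) (D : {set H}) (o : {perm H}) (x : H) :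
    matching D o -> x \in D -> #|D| = #|D :\ x :\ o x| + 2.
Proof.
move=> oD xD; rewrite (cardsD1 x D) xD (cardsD1 (o x) (D :\ x)).
by rewrite !inE (matching_neq oD xD) (matching_mem x oD) xD; lia.
Qed.

Lemma matching0 (H : finType) (o : {perm H}) : matching set0 o = (o == 1%g).
Proof.
apply/idP/eqP => [oD|->]; last by apply/matchingP; split=> x; rewrite !perm1 // eqxx inE.
by apply/permP => x; rewrite perm1 (matching_fix oD) ?inE.
Qed.

(** * Euler's formula *)

(** Induction on the edges, starting from the colouring of X by the cycles of r,
    for which V = F and there are no edges. Adding the edge x, o x multiplies the
    face permutation by a transposition. If x and o x lie on the same face, this
    face is cut and the colours stay. Otherwise two faces are joined, and either
    x and o x had different colours, which are then identified, or they had the same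
    colour and the genus g goes up by one. *)
Lemma euler_colouring (H : finType) (X D : {set H}) (r o : {perm H}) :
    matching D o -> D \subset X -> stable r X ->
  exists (f : H -> {set H}) (g : nat),
    [/\ {in X, forall x, f (r x) = f x}, {in X, forall x, f (o x) = f x}
      & 2 * norb r X + 2 * norb (o * r)%g X + 4 * g = #|D| + 4 * #|f @: X|].
Proof.
move=> oD DX rX; have [m] := ubnP #|D|; elim: m => // m IH in D o oD DX *.
have [D0|[x xD]] := set_0Vmem D => Dm.
  move: oD; rewrite D0 matching0 => /eqP ->; exists (porbit r), 0; split=> [x _|x _|].
  - by rewrite -(porbit_perm r 1 x) expg1.
  - by rewrite perm1.
  by rewrite mul1g cards0 /norb; lia.
set D' := D :\ x :\ o x; set t := tperm x (o x).
have oD' := matching_remove oD xD; rewrite -/D' -/t in oD'.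
have cD := card_matching_remove oD xD; rewrite -/D' in cD.
have D'X : D' \subset X.
  by apply: subset_trans DX; rewrite /D' setDDl subsetDl.
have xX : x \in X by apply: (subsetP DX).
have yX : o x \in X by apply: (subsetP DX); rewrite (matching_mem x oD).
have xy : x != o x by rewrite eq_sym (matching_neq oD xD).
have {IH}[|f [g [fr fo fE]]] := IH D' _ oD' D'X; first by lia.
have pX : stable (t * o * r)%g X by apply: stableM => //; apply: matching_stable D'X.
have := norb_tperm pX xX yX xy; rewrite -/t !mulgA tperm2 mul1g.
move: fE; move: (norb (t * o * r)%g X) (norb (o * r)%g X) (norb r X) => F' F V fE nE.
rewrite {}cD; move: #|D'| fE => d fE.
have fo' z : z \in X -> z != x -> z != o x -> f (o z) = f z.
  move=> zX zx zy; rewrite -(fo z zX) permM tpermD // 1?eq_sym //.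
have [/eqP fxy|fxy] := boolP (f x == f (o x)).
  have fo2 z : z \in X -> f (o z) = f z.
    move=> zX; have [->|zx] := eqVneq z x; first by rewrite -fxy.
    have [->|zy] := eqVneq z (o x); first by rewrite (matching_invol x oD) fxy.
    exact: fo'.
  case: (boolP (x \in _)) nE => _ /= nE; rewrite -muln2 in nE.
    by exists f, g; split=> //; move: #|f @: X| fE => k fE; lia.
  by exists f, g.+1; split=> //; move: #|f @: X| fE => k fE; lia.
have xNy : x \notin porbit (t * o * r)%g (o x).
  apply: contraNN fxy => /porbitP[i xi]; apply/eqP.
  rewrite [in LHS]xi permX {xi}; elim: i => //= i IH.
  have iX : iter i (t * o * r)%g (o x) \in X.
    by rewrite -permX (porbit_stable pX (mem_porbit _ i _)).
  rewrite permM fr ?fo //; move: iX; set z := iter _ _ _.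
  by have /stableP -> := matching_stable oD' D'X.
rewrite xNy /= -muln2 in nE.
(* the colour of o x is replaced by that of x *)
pose f' z := if f z == f (o x) then f x else f z.
exists f', g; split=> [z zX|z zX|].
- by rewrite /f' fr.
- rewrite /f'; have [->|zx] := eqVneq z x; first by rewrite eqxx (negPf fxy).
  have [->|zy] := eqVneq z (o x); last by rewrite fo'.
  by rewrite (matching_invol x oD) eqxx (negPf fxy).
have -> : f' @: X = f @: X :\ f (o x).
  apply/setP => c; rewrite !inE; apply/imsetP/andP => [[z zX ->]|[cy /imsetP[z zX zc]]].
    rewrite /f'; case: (eqVneq (f z) (f (o x))) => [_|zy].
      by rewrite fxy imset_f.
    by rewrite zy imset_f.
  by exists z => //; rewrite /f' -zc (negPf cy).
have := cardsD1 (f (o x)) (f @: X); rewrite imset_f //.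
by lia.
Qed.

(** For a connected graph the colouring above is constant. This is the existence
    and the nonnegativity of the genus, which makes the two parts left by the
    removal of a separating loop countable by their genera. *)
Lemma euler_formula (H : finType) (X D : {set H}) (r o : {perm H}) :
    matching D o -> D \subset X -> stable r X -> X != set0 ->
    transitive_on X r o ->
  exists g, 2 * norb r X + 2 * norb (o * r)%g X + 4 * g = #|D| + 4.
Proof.
move=> oD DX rX /set0Pn[x xX] /transitiveP tr.
have [f [g [fr fo fE]]] := euler_colouring oD DX rX; exists g.
have oX := matching_stable oD DX.
suff c1 : #|f @: X| = 1 by rewrite fE c1.
have XE : [set z in X | f z == f x] = X.
  apply: tr.
  - by apply/subsetP=> z; rewrite inE => /andP[].
  - by apply/set0Pn; exists x; rewrite inE xX /=.
  - apply: stable_sub => z; rewrite !inE => /andP[zX fz].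
    by move/stableP: rX => ->; rewrite zX fr.
  - apply: stable_sub => z; rewrite !inE => /andP[zX fz].
    by move/stableP: oX => ->; rewrite zX fo.
apply/eqP/cards1P; exists (f x); apply/setP => c; rewrite inE.
apply/imsetP/eqP => [[z + ->]|->]; last by exists x.
by rewrite -XE inE => /andP[_ /eqP].
Qed.

(** * Removing an edge *)

Lemma maps_sum_partner (H : finType) (X D : {set H}) (r : {perm H}) (g : nat) (x : H) :
    x \in D ->
  #|maps X r D g| = \sum_(y in D :\ x) #|[set o in maps X r D g | o x == y]|.
Proof.
move=> xD; apply: card_indexed_union => [y o _|o oM]; first by rewrite inE => /andP[].
rewrite inE in oM; have /and3P[oD _ _] := oM.
apply/eqP/cards1P; exists (o x); apply/setP => y; rewrite !inE oM /= [o x == y]eq_sym.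
have [->|] := eqVneq y (o x); last by rewrite andbF.
by rewrite (matching_neq oD xD) (matching_mem x oD) xD.
Qed.

Lemma matching_tperm (H : finType) (D : {set H}) (o : {perm H}) (x y : H) :
    x \in D -> y \in D -> x != y ->
  matching D o && (o x == y) = matching (D :\ x :\ y) (tperm x y * o)%g.
Proof.
move=> xD yD xy; apply/andP/idP => [[oD /eqP <-]|oD]; first exact: matching_remove.
have xD' : x \notin D :\ x :\ y by rewrite !inE eqxx andbF.
have yD' : y \notin D :\ x :\ y by rewrite !inE eqxx.
have := matching_add oD xD' yD' xy; rewrite mulgA tperm2 mul1g.
have -> : x |: (y |: D :\ x :\ y) = D.
  by rewrite [y |: _]setD1K ?setD1K // !inE eq_sym xy.
by move=> ->; rewrite -{1}(tpermR x y) -permM (matching_fix oD).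
Qed.

Lemma tperm_matching_comm (H : finType) (D : {set H}) (o : {perm H}) (x y : H) :
    matching D o -> x \notin D -> y \notin D ->
  (tperm x y * o)%g = (o * tperm x y)%g.
Proof. by move=> oD xD yD; rewrite conjgC tpermJ !(matching_fix oD). Qed.

(** What the removal of the edge x, y leaves of a map: a matching o of the other
    half-edges, such that putting the edge back gives a map of genus g. As
    tperm x y commutes with o, the face permutation of the original map is
    o * (tperm x y * r): the faces are those of o with rotation
    tperm x y * r. The constant 6 takes the two missing half-edges into account. *)
Definition edge_removed_maps (H : finType) (X D : {set H}) (r : {perm H})
    (g : nat) (x y : H) : {set {perm H}} :=
  [set o | [&& matching (D :\ x :\ y) o, transitive_on X r (tperm x y * o)%g
     & 2 * norb r X + 2 * norb (o * (tperm x y * r))%g X + 4 * g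
       == #|D :\ x :\ y| + 6]].

Lemma card_maps_partner (H : finType) (X D : {set H}) (r : {perm H}) (g : nat) (x y : H) :
    x \in D -> y \in D -> x != y ->
  #|[set o in maps X r D g | o x == y]| = #|edge_removed_maps X D r g x y|.
Proof.
move=> xD yD xy.
rewrite -(card_imset (mem (edge_removed_maps X D r g x y)) (mulgI (tperm x y))).
have xD' : x \notin D :\ x :\ y by rewrite !inE eqxx andbF.
have yD' : y \notin D :\ x :\ y by rewrite !inE eqxx.
have cD : #|D| = #|D :\ x :\ y| + 2.
  by rewrite (cardsD1 x D) xD (cardsD1 y (D :\ x)) !inE eq_sym xy yD; lia.
have main o : (tperm x y * o \in edge_removed_maps X D r g x y)%g
            = (o \in [set o in maps X r D g | o x == y]).
  rewrite !inE mulgA tperm2 mul1g -matching_tperm //.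
  case oM: (matching D o && (o x == y)); last first.
    by apply/esym; apply: contraFF oM => /andP[/and3P[-> _ _] ->].
  have /andP[-> ->] := oM; rewrite /= andbT; congr (_ && _).
  have -> : (tperm x y * o * (tperm x y * r) = o * r)%g.
    move: oM; rewrite matching_tperm // => oM; have := tperm_matching_comm oM xD' yD'.
    by rewrite mulgA tperm2 mul1g => E; rewrite mulgA -E.
  by rewrite cD; congr (_ == _); lia.
apply: eq_card => o; apply/idP/imsetP => [|[o' + ->]].
  rewrite -main => oM; exists (tperm x y * o)%g => //.
  by rewrite mulgA tperm2 mul1g.
by rewrite -main mulgA tperm2 mul1g.
Qed.

(** Since o fixes y, a set stable under tperm x y * o contains x as soon as it
    contains y, and conversely. *)
Lemma stable_edge (H : finType) (D Y : {set H}) (o : {perm H}) (x y : H) :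
    matching (D :\ x :\ y) o ->
  stable (tperm x y * o)%g Y = stable (tperm x y) Y && stable o Y.
Proof.
move=> oD; have oy : o y = y by apply: (matching_fix oD); rewrite !inE eqxx.
apply/idP/andP => [st|[tY oY]]; last exact: stableM.
have tY : stable (tperm x y) Y.
  by rewrite stable_tperm; move/stableP/(_ x): st; rewrite permM tpermL oy => ->.
by split=> //; rewrite -(stable_mulKl _ tY).
Qed.

(** Contracting an edge with distinct ends: tperm x y * r joins their cycles, so
    that there is one vertex less, one edge less, and the same faces. Both
    connectedness conditions amount to stability under r, tperm x y and o, because
    x and y lie on one cycle of tperm x y * r. *)
Lemma edge_removed_maps_merge (H : finType) (X D : {set H}) (r : {perm H}) (g : nat) (x y : H) :
    stable r X -> D \subset X -> x \in D -> y \in D -> y \notin porbit r x ->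
  edge_removed_maps X D r g x y = maps X (tperm x y * r)%g (D :\ x :\ y) g.
Proof.
move=> rX DX xD yD yx.
have xy : x != y by apply: contraNneq yx => <-; apply: porbit_id.
have nE := norb_tperm rX (subsetP DX x xD) (subsetP DX y yD) xy.
rewrite porbit_sym yx /= in nE.
have yx' : x \in porbit (tperm x y * r)%g y by rewrite porbit_tperm_merge // porbit_sym.
apply/setP => o; rewrite !inE; have [oD /=|//] := boolP (matching _ o).
congr (_ && _); last by rewrite -muln2 in nE; apply/eqP/eqP; lia.
apply: eq_forallb => Y; congr (_ ==> _); congr [&& _, _ & _].
rewrite (stable_edge Y oD); apply/and3P/andP => [[rY tY oY]|[rY oY]].
  by split=> //; apply: stableM.
have tY : stable (tperm x y) Y by rewrite stable_tperm (porbit_stable rY yx').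
by rewrite tY -(stable_mulKl r tY) rY.
Qed.

Lemma perm_restrict (H : finType) (o : {perm H}) (Y : {set H}) :
  stable o Y -> exists o1 : {perm H}, forall x, o1 x = if x \in Y then o x else x.
Proof.
move=> /stableP oY; pose f x := if x \in Y then o x else x.
have f_inj : injective f.
  move=> x z; rewrite /f; case: ifP => xY; case: ifP => zY; first exact: perm_inj.
  - by move=> xz; rewrite -xz oY xY in zY.
  - by move=> xz; rewrite xz oY zY in xY.
  by [].
by exists (perm f_inj) => x; rewrite permE.
Qed.

Lemma transitive_agree (H : finType) (Y : {set H}) (r o o' : {perm H}) :
  {in Y, o =1 o'} -> transitive_on Y r o = transitive_on Y r o'.
Proof.
move=> eo; apply: eq_forallb => Z; congr (_ ==> _).
have [ZY /=|//] := boolP (Z \subset Y); congr [&& _, _ & _].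
apply/idP/idP => /stableP oZ; apply: stable_sub => z zZ; have zY := subsetP ZY z zZ.
  by rewrite -eo // oZ.
by rewrite eo // oZ.
Qed.

Definition split_maps (H : finType) (X Y D : {set H}) (r : {perm H}) (g1 g2 : nat) :
    {set {perm H}} :=
  [set o | [&& matching D o, stable o Y,
     transitive_on Y r o, transitive_on (X :\: Y) r o,
     2 * norb r Y + 2 * norb (o * r)%g Y + 4 * g1 == #|D :&: Y| + 4
   & 2 * norb r (X :\: Y) + 2 * norb (o * r)%g (X :\: Y) + 4 * g2
     == #|D :\: Y| + 4]].

(** A map with two parts Y and X minus Y is the product of its restrictions, each
    extended by the identity. *)
Lemma card_split_maps (H : finType) (X Y D : {set H}) (r : {perm H}) (g1 g2 : nat) :
    stable r X -> stable r Y -> D \subset X ->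
  #|split_maps X Y D r g1 g2| =
  #|maps Y r (D :&: Y) g1| * #|maps (X :\: Y) r (D :\: Y) g2|.
Proof.
move=> rX rY DX; have rZ := stableD rX rY.
pose glue (u : {perm H} * {perm H}) := (u.1 * u.2)%g.
pose A := setX (maps Y r (D :&: Y) g1) (maps (X :\: Y) r (D :\: Y) g2).
have DY : D :&: Y \subset Y by apply: subsetIr.
have DZ : D :\: Y \subset X :\: Y by apply: setSD.
have glueE o1 o2 : matching (D :&: Y) o1 -> matching (D :\: Y) o2 ->
    forall x, (o1 * o2)%g x = if x \in Y then o1 x else o2 x.
  move=> o1D o2D x; rewrite permM; case: ifP => xY.
    rewrite (matching_fix o2D) // !inE.
    by have /stableP -> := matching_stable o1D DY; rewrite xY.
  by rewrite (matching_fix o1D) // !inE xY andbF.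
have matchE (o1 o2 o : {perm H}) : (forall x, o x = if x \in Y then o1 x else o2 x) ->
   (forall x, x \notin Y -> o1 x = x) -> (forall x, x \in Y -> o2 x = x) ->
   stable o1 Y -> stable o2 Y ->
   matching D o && stable o Y = matching (D :&: Y) o1 && matching (D :\: Y) o2.
  move=> oE o1E o2E /stableP o1Y /stableP o2Y.
  have -> : stable o Y.
    by apply/stableP => x; rewrite oE; case: ifP => xY; rewrite ?o1Y ?o2Y.
  rewrite andbT; apply/idP/andP => [/matchingP[oK oD]|[/matchingP[K1 D1] /matchingP[K2 D2]]].
    split; apply/matchingP; split=> x.
    - have [xY|xY] := boolP (x \in Y); last by rewrite !o1E.
      by have := oK x; rewrite !oE xY o1Y xY.
    - have [xY|xY] := boolP (x \in Y); last by rewrite !o1E // eqxx inE (negPf xY) andbF.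
      by have := oD x; rewrite oE xY inE xY andbT.
    - have [xY|xY] := boolP (x \in Y); first by rewrite !o2E.
      by have := oK x; rewrite !oE (negPf xY) o2Y (negPf xY).
    - have [xY|xY] := boolP (x \in Y); first by rewrite !o2E // eqxx inE xY.
      by have := oD x; rewrite oE (negPf xY) inE xY.
  apply/matchingP; split=> x; rewrite !oE; have [xY|xY] := boolP (x \in Y).
  - by rewrite o1Y xY K1.
  - by rewrite o2Y (negPf xY) K2.
  - by rewrite D1 inE xY andbT.
  by rewrite D2 inE xY.
have agree (o1 o2 o : {perm H}) : (forall x, o x = if x \in Y then o1 x else o2 x) ->
   (forall x, x \notin Y -> o1 x = x) -> (forall x, x \in Y -> o2 x = x) ->
   stable o1 Y -> stable o2 Y ->
   (o \in split_maps X Y D r g1 g2) = ((o1, o2) \in A).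
  move=> oE o1E o2E o1Y o2Y; rewrite !inE /=.
  have e1 : {in Y, o =1 o1} by move=> x xY; rewrite oE xY.
  have e2 : {in X :\: Y, o =1 o2}.
    by move=> x; rewrite inE oE => /andP[/negPf-> _].
  rewrite (transitive_agree r e1) (transitive_agree r e2).
  rewrite andbA (matchE o1 o2 o) //.
  have [/andP[M1 M2]|] := boolP (matching (D :&: Y) o1 && _); last first.
    by rewrite negb_and => /orP[/negPf-> //|/negPf-> /=]; rewrite andbF.
  have -> : norb (o * r)%g Y = norb (o1 * r)%g Y.
    apply/esym/norb_agree => [|x xY]; first by apply: stableM.
    by rewrite !permM e1.
  have -> : norb (o * r)%g (X :\: Y) = norb (o2 * r)%g (X :\: Y).
    apply/esym/norb_agree => [|x xY]; first by apply: stableM => //; apply: matching_stable DZ.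
    by rewrite !permM e2.
  by rewrite M1 M2 /=; do ![case: (_ == _) | case: (transitive_on _ _ _)].
rewrite -cardsX -/A -(@card_in_imset _ _ glue A).
  apply: eq_card => o; apply/idP/imsetP => [oS|[[o1 o2] + ->]].
    have : stable o Y by move: oS; rewrite inE => /and5P[].
    move=> oY; have [o1 o1E] := perm_restrict oY.
    have oYC : stable o (~: Y) by rewrite -setTD; apply: stableD oY; apply: stableT.
    have [o2 o2E] := perm_restrict oYC.
    have oE x : o x = if x \in Y then o1 x else o2 x.
      by rewrite o1E o2E inE; case: (x \in Y).
    have oA : (o1, o2) \in A.
      rewrite -(agree o1 o2 o) //.
      - by move=> x xY; rewrite o1E (negPf xY).
      - by move=> x xY; rewrite o2E inE xY.
      - by apply: stable_sub => x xY; rewrite o1E xY; move/stableP: oY => ->.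
      by apply: stable_sub => x xY; rewrite o2E inE xY.
    exists (o1, o2) => //; apply/permP => x; rewrite oE glueE //.
      by move: oA; rewrite !inE => /andP[/andP[]].
    by move: oA; rewrite !inE => /andP[_ /andP[]].
  move=> oA; have [M1 M2] : matching (D :&: Y) o1 /\ matching (D :\: Y) o2.
    by move: oA; rewrite !inE => /andP[/andP[-> _] /andP[-> _]].
  rewrite (agree o1 o2) //.
  - exact: glueE.
  - by move=> x xY; rewrite (matching_fix M1) // inE (negPf xY) andbF.
  - by move=> x xY; rewrite (matching_fix M2) // inE xY.
  - exact: matching_stable DY.
  by apply: stable_sub => x xY; rewrite (matching_fix M2) // inE xY.
move=> [o1 o2] [p1 p2] oA pA /= E.
have [M1 M2] : matching (D :&: Y) o1 /\ matching (D :\: Y) o2.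
  by move: oA; rewrite !inE => /andP[/andP[-> _] /andP[-> _]].
have [N1 N2] : matching (D :&: Y) p1 /\ matching (D :\: Y) p2.
  by move: pA; rewrite !inE => /andP[/andP[-> _] /andP[-> _]].
have Ex x : (if x \in Y then o1 x else o2 x) = (if x \in Y then p1 x else p2 x).
  by rewrite -!glueE //; congr (fun_of_perm _ x).
congr (_, _); apply/permP => x; have := Ex x; case: ifP => // xY _.
  by rewrite !(matching_fix M1, matching_fix N1) // inE xY andbF.
by rewrite !(matching_fix M2, matching_fix N2) // inE xY.
Qed.

(** The candidates for the connected component of x, when the removal of the
    loop x, y leaves y in another component; r is the rotation after the removal. *)
Definition cuts (H : finType) (X : {set H}) (r : {perm H}) (x y : H) : {set {set H}} :=
  [set Y : {set H} | [&& Y \subset X, stable r Y, x \in Y & y \notin Y]].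

(** Stable sets that do not separate x from y remain stable when the edge is put
    back. *)
Lemma edge_removed_cut (H : finType) (X D Z : {set H}) (r o : {perm H}) (x y : H) :
    matching (D :\ x :\ y) o -> transitive_on X r (tperm x y * o)%g ->
    Z \subset X -> Z != set0 -> (x \in Z) = (y \in Z) ->
    stable (tperm x y * r)%g Z -> stable o Z ->
  Z = X.
Proof.
move=> oD /transitiveP tr ZX Z0 xyZ rZ oZ.
have tZ : stable (tperm x y) Z by rewrite stable_tperm xyZ.
by apply: tr => //; [rewrite -(stable_mulKl r tZ) | rewrite (stable_edge _ oD) tZ].
Qed.

(** Removing a separating loop from a graph with v vertices, d half-edges left
    and f faces: the genera of the two parts add up to the genus. *)
Lemma genus_addE (d d1 d2 v v1 v2 f f1 f2 g g1 g2 : nat) :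
    d1 + d2 = d -> v + 1 = v1 + v2 -> f = f1 + f2 ->
    2 * v1 + 2 * f1 + 4 * g1 = d1 + 4 -> 2 * v2 + 2 * f2 + 4 * g2 = d2 + 4 ->
  (g1 + g2 == g) = (2 * v + 2 * f + 4 * g == d + 6).
Proof. by move=> *; apply/eqP/eqP; lia. Qed.

Lemma euler_formula_on (H : finType) (Y D : {set H}) (r o : {perm H}) :
    matching D o -> stable o Y -> stable r Y -> Y != set0 ->
    transitive_on Y r o ->
  exists g, 2 * norb r Y + 2 * norb (o * r)%g Y + 4 * g = #|D :&: Y| + 4.
Proof.
move=> oD oY rY Y0; have [o1 o1E] := perm_restrict oY.
have agree : {in Y, o =1 o1} by move=> x xY; rewrite o1E xY.
have o1D : matching (D :&: Y) o1.
  case/matchingP: oD => oK oN; apply/matchingP; split=> x; rewrite o1E; last first.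
    by rewrite inE; case: ifP => xY; rewrite ?oN ?andbT ?andbF ?eqxx.
  by rewrite !o1E; case: (boolP (x \in Y)) => xY; rewrite ?(negPf xY) // (stableP _ _ oY) xY oK.
rewrite (transitive_agree r agree) => tr.
have oX : stable (o * r)%g Y by apply: stableM.
rewrite (@norb_agree _ (o * r)%g (o1 * r)%g) //.
  by apply: euler_formula tr => //; apply: subsetIr.
by move=> x xY; rewrite !permM agree.
Qed.

Section Loop.
Context (H : finType) (X D : {set H}) (r : {perm H}) (g : nat) (x y : H).
Hypotheses (rX : stable r X) (DX : D \subset X) (xD : x \in D) (yD : y \in D)
  (xy : x != y) (yx : y \in porbit r x).
Local Notation r' := (tperm x y * r)%g.
Local Notation D' := (D :\ x :\ y).

Let xX : x \in X. Proof. exact: (subsetP DX). Qed.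
Let yX : y \in X. Proof. exact: (subsetP DX). Qed.
Let D'X : D' \subset X.
Proof. by apply: subset_trans DX; rewrite setDDl subsetDl. Qed.
Let r'X : stable r' X.
Proof. by apply: stableM => //; rewrite stable_tperm xX yX. Qed.
Let norb_loop : norb r' X = norb r X + 1.
Proof. by rewrite -(norb_tperm rX xX yX xy) porbit_sym yx addn0. Qed.

(** When the rest stays connected, the loop was a handle: one vertex more, one
    edge less and the same faces lower the genus by one. In genus 0 this
    contradicts Euler's formula. *)
Lemma edge_removed_connected :
  #|[set o in edge_removed_maps X D r g x y | transitive_on X r' o]|
  = if g is g'.+1 then #|maps X r' D' g'| else 0.
Proof.
have X0 : X != set0 by apply/set0Pn; exists x.
have tr_edge o : matching D' o -> transitive_on X r' o ->
    transitive_on X r (tperm x y * o)%g.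
  move=> oD /transitiveP tr; apply/transitiveP => Y YX Y0 rY.
  by rewrite (stable_edge _ oD) => /andP[tY oY]; apply: tr => //; apply: stableM.
case: g => [|g'].
  apply/eqP; rewrite cards_eq0; apply/eqP/setP => o; rewrite !inE.
  apply/negP => /andP[/and3P[oD _ /eqP gE] tr].
  have [h hE] := euler_formula oD D'X r'X X0 tr.
  move: gE hE; rewrite norb_loop; move: #|_| (norb _ X) (norb r X) => d f v gE hE.
  by clear -gE hE; lia.
apply: eq_card => o; rewrite !inE.
have [oD /=|//] := boolP (matching D' o).
have [tr|] := boolP (transitive_on X r' o); last by rewrite andbF.
rewrite tr_edge //= andbT norb_loop; move: #|_| (norb _ X) (norb r X) => d f v.
by apply/eqP/eqP; clear; lia.
Qed.

(** When the rest is disconnected, a proper stable set must separate x from y,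
    because otherwise it would be stable in the original map. There is exactly one
    such set containing x: the difference of two of them contains neither x nor y,
    hence is empty. *)
Lemma edge_removed_disconnected :
  #|[set o in edge_removed_maps X D r g x y | ~~ transitive_on X r' o]|
  = \sum_(g1 < g.+1) \sum_(g2 < g.+1 | g1 + g2 == g) \sum_(Y in cuts X r' x y)
      #|maps Y r' (D' :&: Y) g1| * #|maps (X :\: Y) r' (D' :\: Y) g2|.
Proof.
pose J (i : 'I_g.+1 * ('I_g.+1 * {set H})) :=
  (i.1 + i.2.1 == g) && (i.2.2 \in cuts X r' x y).
pose Q (i : 'I_g.+1 * ('I_g.+1 * {set H})) := split_maps X i.2.2 D' r' i.1 i.2.1.
transitivity (\sum_(i | J i) #|Q i|); last first.
  transitivity (\sum_(g1 < g.+1) \sum_(j : 'I_g.+1 * {set H} | J (g1, j)) #|Q (g1, j)|).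
    by rewrite pair_big_dep; apply: eq_big => [[g1 [g2 Y]]|[g1 [g2 Y]]].
  apply: eq_bigr => g1 _.
  transitivity (\sum_(g2 < g.+1 | g1 + g2 == g) \sum_(Y in cuts X r' x y)
                  #|Q (g1, (g2, Y))|).
    by rewrite pair_big_dep; apply: eq_big => [[g2 Y]|[g2 Y]].
  apply: eq_bigr => g2 _; apply: eq_bigr => Y; rewrite inE => /and4P[_ rY _ _].
  exact: card_split_maps.
apply: card_indexed_union.
- move=> [g1 [g2 Y]] o /andP[/= /eqP gE]; rewrite inE => /and4P[YX rY xY yY].
  rewrite !inE /= => /and5P[oD oY /transitiveP tY /transitiveP tZ /andP[/eqP e1 /eqP e2]].
  rewrite oD /=; apply/andP; split; first apply/andP; first split.
  + apply/transitiveP => Z ZX Z0 rZ; rewrite (stable_edge _ oD) => /andP[tpZ oZ].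
    have r'Z : stable r' Z by apply: stableM.
    have [ZY|] := eqVneq (Z :&: Y) set0.
      have ZE : Z = X :\: Y.
        apply: tZ => //.
        by rewrite subsetD ZX -setI_eq0 ZY eqxx.
      by move: tpZ; rewrite stable_tperm ZE !inE xY yY xX yX.
    move/tY => /(_ (subsetIr _ _) (stableI r'Z rY) (stableI oZ oY)) /setIidPr YZ.
    have [ZY|] := eqVneq (Z :\: Y) set0.
      move/eqP: ZY; rewrite setD_eq0 => ZY.
      have ZE : Z = Y by apply/eqP; rewrite eqEsubset ZY YZ.
      by move: tpZ; rewrite stable_tperm ZE xY (negPf yY).
    move/tZ => /(_ (setSD _ ZX) (stableD r'Z rY) (stableD oZ oY)) ZE.
    by rewrite -(setID Z Y) -(setID X Y) ZE (setIidPr YZ) (setIidPr YX).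
  + have c := cardsID Y D'.
    have n1 := norb_split rY YX.
    have oX : stable (o * r')%g Y by apply: stableM.
    have n2 := norb_split oX YX.
    rewrite norb_loop in n1.
    by rewrite -(genus_addE _ c n1 n2 e1 e2) /= gE.
  apply/negP => /transitiveP /(_ Y YX _ rY oY) YE.
  have : Y = X by apply: YE; apply/set0Pn; exists x.
  by move=> E; rewrite E yX in yY.
move=> o; rewrite inE => /andP[]; rewrite inE => /and3P[oD tr /eqP gE].
have key := edge_removed_cut oD tr.
case/forallPn => Y0; rewrite negb_imply => /andP[/and4P[YX0 Y00 rY0 oY0] YE0].
have oX : stable o X by apply: matching_stable D'X.
have {Y0 YX0 Y00 rY0 oY0 YE0} [Y [YX rY oY xY yY]] : exists Y : {set H},
    [/\ Y \subset X, stable r' Y, stable o Y, x \in Y & y \notin Y].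
  have [xY|xY] := boolP (x \in Y0).
    exists Y0; split=> //; apply: contraNN YE0 => yY; apply/eqP/key => //.
    by rewrite xY yY.
  exists (X :\: Y0); split; rewrite ?subsetDl ?inE ?xY //; try exact: stableD.
  rewrite yX andbT negbK; apply: contraNT YE0 => yY; apply/eqP/key => //.
  by rewrite (negPf xY) (negPf yY).
have YC : Y \in cuts X r' x y by rewrite inE YX rY xY yY.
have Y0 : Y != set0 by apply/set0Pn; exists x.
have Z0 : X :\: Y != set0 by apply/set0Pn; exists y; rewrite inE yY yX.
have sub_eq (Y1 Y2 : {set H}) : Y1 \in cuts X r' x y -> stable o Y1 ->
    Y2 \in cuts X r' x y -> stable o Y2 -> Y1 \subset Y2.
  rewrite !inE => /and4P[Y1X rY1 xY1 yY1] oY1 /and4P[Y2X rY2 xY2 yY2] oY2.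
  rewrite -setD_eq0; apply: contraT => d0.
  have : Y1 :\: Y2 = X.
    apply: key => //; rewrite ?inE ?xY2 ?(negPf yY1) ?andbF //; try exact: stableD.
    by apply: subset_trans Y1X; apply: subsetDl.
  by move=> E; move: xX; rewrite -E inE xY2.
have trY : transitive_on Y r' o.
  apply/transitiveP => Z ZY Zn0 rZ oZ.
  have yZ : y \notin Z by apply: contraNN yY => /(subsetP ZY).
  have [xZ|xZ] := boolP (x \in Z).
    apply/eqP; rewrite eqEsubset ZY; apply: sub_eq => //.
    by rewrite inE (subset_trans ZY YX) rZ xZ yZ.
  have ZE : Z = X by apply: key; rewrite ?(subset_trans ZY YX) ?(negPf xZ) ?(negPf yZ).
  by rewrite ZE xX in xZ.
have trZ : transitive_on (X :\: Y) r' o.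
  apply/transitiveP => Z; rewrite subsetD => /andP[ZX ZY] Zn0 rZ oZ.
  have xZ : x \notin Z.
    by apply/negP => xZ; move: ZY; rewrite disjoint_sym => /disjointFr/(_ xY); rewrite xZ.
  have [yZ|yZ] := boolP (y \in Z).
    have XZ : X :\: Z \subset Y.
      apply: sub_eq => //; last exact: stableD.
      by rewrite !inE subsetDl xX xZ yZ stableD.
    apply/eqP; rewrite eqEsubset subsetD ZX ZY /=.
    apply/subsetP => z; rewrite inE => /andP[zY zX]; apply: contraNT zY => zZ.
    by apply: (subsetP XZ); rewrite inE zZ zX.
  have ZE : Z = X by apply: key; rewrite ?(negPf xZ) ?(negPf yZ).
  by rewrite ZE xX in xZ.
have [h1 e1] := euler_formula_on oD oY rY Y0 trY.
have [h2 e2] := euler_formula_on oD (stableD oX oY) (stableD r'X rY) Z0 trZ.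
have DZ : D' :&: (X :\: Y) = D' :\: Y by rewrite setIDA (setIidPl D'X).
rewrite DZ in e2.
have hE : h1 + h2 = g.
  have c := cardsID Y D'.
  have n1 := norb_split rY YX.
  have oX' : stable (o * r')%g Y by apply: stableM.
  have n2 := norb_split oX' YX.
  rewrite norb_loop in n1.
  by apply/eqP; rewrite (genus_addE _ c n1 n2 e1 e2) gE.
have h1g : h1 < g.+1 by rewrite ltnS -hE leq_addr.
have h2g : h2 < g.+1 by rewrite ltnS -hE leq_addl.
apply/eqP/cards1P; exists (Ordinal h1g, (Ordinal h2g, Y)).
apply/setP => -[k1 [k2 W]]; rewrite in_set in_set1 /J /Q [o \in _]in_set /=.
apply/andP/eqP => [[/andP[_ WC] /and5P[_ oW _ _ /andP[/eqP f1 /eqP f2]]]|[-> -> ->]].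
  have WY : W = Y by apply/eqP; rewrite eqEsubset !sub_eq.
  rewrite WY in f1 f2 *; congr (_, (_, _)); apply: val_inj => /=.
    by move: f1; rewrite -e1 => /eqP; rewrite eqn_add2l eqn_pmul2l // => /eqP.
  by move: f2; rewrite -e2 => /eqP; rewrite eqn_add2l eqn_pmul2l // => /eqP.
rewrite /= hE YC eqxx oD oY trY trZ /=; split=> //.
by rewrite e1 e2 !eqxx.
Qed.
End Loop.

(** * First-return permutations *)

(** The permutation s sends a point of D to the next point of D on its r-cycle;
    it describes the rotation once the marks are erased. *)
Definition first_return (H : finType) (D : {set H}) (r s : {perm H}) : Prop :=
  stable s D /\
  {in D, forall x, exists k, s x = iter k.+1 r x /\
     forall j, 0 < j <= k -> iter j r x \notin D}.

Lemma iter_perm_inj (H : finType) (r : {perm H}) i : injective (iter i r).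
Proof. by move=> x y; rewrite -!permX; apply: perm_inj. Qed.

Lemma first_return_exists (H : finType) (D : {set H}) (r : {perm H}) :
  exists s, first_return D r s.
Proof.
pose tr x := traject r (r x) #|porbit r x|.
pose k x := find (mem D) (tr x).
pose f x := if x \in D then iter (k x).+1 r x else x.
have kD x : x \in D -> iter (k x).+1 r x \in D /\
    forall j, 0 < j <= k x -> iter j r x \notin D.
  move=> xD; have hs : has (mem D) (tr x).
    apply/hasP; exists x => //; apply/trajectP; exists #|porbit r x|.-1.
      by rewrite prednK // lt0n card_porbit_neq0.
    by rewrite -iterSr prednK ?iter_porbit // lt0n card_porbit_neq0.
  have klt : k x < #|porbit r x| by rewrite /k -[ltnRHS](size_traject r (r x)) -has_find.
  have := nth_find (r x) hs; rewrite -/(k x) /tr nth_traject // -iterSr => kx; split=> // -[//|j] /= jk.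
  have := @before_find _ (r x) (mem D) (tr x) j jk; rewrite /tr nth_traject ?(ltn_trans jk) //.
  by rewrite -iterSr => /= ->.
have f_inj : injective f.
  have aux x y : x \in D -> y \in D -> f x = f y -> k x <= k y -> x = y.
    rewrite /f => xD yD; rewrite xD yD => fxy kxy.
    have : iter (k x).+1 r x = iter (k x).+1 r (iter (k y - k x) r y).
      by rewrite -iterD fxy addSn subnKC.
    move/iter_perm_inj => xy; case: (posnP (k y - k x)) => [k0|kp]; first by rewrite xy k0.
    have [_ /(_ (k y - k x))] := kD y yD; rewrite -xy xD kp leq_subr.
    by move=> /(_ isT).
  move=> x y fxy; have [xD|xD] := boolP (x \in D); have [yD|yD] := boolP (y \in D).
  - by case/orP: (leq_total (k x) (k y)) => h; [|apply/esym]; apply: aux.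
  - by have := (kD x xD).1; move: fxy; rewrite /f xD (negPf yD) => ->; rewrite (negPf yD).
  - by have := (kD y yD).1; move: fxy; rewrite /f yD (negPf xD) => <-; rewrite (negPf xD).
  by move: fxy; rewrite /f (negPf xD) (negPf yD).
exists (perm f_inj); split.
  by apply: stable_sub => x xD; rewrite permE /f xD; case: (kD x xD).
by move=> x xD; exists (k x); rewrite permE /f xD; case: (kD x xD).
Qed.

Lemma first_return_porbit (H : finType) (D : {set H}) (r s : {perm H}) (x y : H) :
    first_return D r s -> x \in D -> y \in D ->
  (y \in porbit s x) = (y \in porbit r x).
Proof.
move=> [sD ret] xD yD; apply/idP/idP => [ys|].
  suff sr : stable s (porbit r x :&: D).
    by have := porbit_stable sr ys; rewrite !inE xD yD !andbT porbit_id.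
  apply: stable_sub => z; rewrite !inE => /andP[zr zD].
  have /stableP -> := sD; rewrite zD andbT.
  have [k [-> _]] := ret z zD; rewrite -permX.
  by rewrite (porbit_stable (stable_porbit r x) (mem_porbit _ _ _)).
case/porbitP => m; rewrite permX.
elim/ltn_ind: m => -[|m] IH in x xD * => [->|ym]; first exact: porbit_id.
have [k [sx kD]] := ret x xD.
have km : k <= m.
  by rewrite leqNgt; apply/negP => mk; have := kD m.+1; rewrite mk -ym yD => /(_ isT).
have -> : porbit s x = porbit s (s x) by rewrite -(porbit_perm s 1 x) expg1.
apply: (IH (m - k)); first by rewrite ltnS leq_subr.
  by have /stableP -> := sD.
by rewrite ym sx -iterD addnS subnK.
Qed.

(** A matching fixes the marks, so that erasing them commutes with passing from
    the rotation to the face permutation. *)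
Lemma first_return_matching (H : finType) (D : {set H}) (r s o : {perm H}) :
  matching D o -> first_return D r s -> first_return D (o * r)%g (o * s)%g.
Proof.
move=> oD [sD ret]; split; first exact: stableM (matching_stable oD _) _.
move=> x xD; have oxD : o x \in D by rewrite (matching_mem x oD).
have [k [sx kD]] := ret (o x) oxD; exists k.
have it j : j <= k -> iter j.+1 (o * r)%g x = iter j.+1 r (o x).
  elim: j => [|j IH] jk; first by rewrite /= permM.
  rewrite iterS IH 1?ltnW // permM (matching_fix oD) //.
  by apply: kD; rewrite jk.
split=> [|[//|j] /andP[_ jk]]; first by rewrite permM sx it.
by rewrite it 1?ltnW //; apply: kD; rewrite jk.
Qed.

Definition meets_orbits (H : finType) (X D : {set H}) (r : {perm H}) : Prop :=
  {in X, forall x, exists2 d, d \in D & d \in porbit r x}.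

(** A face made of marks only would be a cycle of r made of marks only. *)
Lemma meets_orbits_matching (H : finType) (X D : {set H}) (r o : {perm H}) :
  matching D o -> meets_orbits X D r -> meets_orbits X D (o * r)%g.
Proof.
move=> oD met x xX; have [d dD dx] := met x xX.
apply/exists_inP; apply: contraT; rewrite negb_exists_in => /forall_inP noD.
have fixY : {in porbit (o * r)%g x, (o * r)%g =1 r}.
  move=> z zx; rewrite permM (matching_fix oD) //.
  by apply/negP => zD; have := noD z zD; rewrite zx.
have E := porbit_agree (stable_porbit _ _) fixY (porbit_id _ x).
by have := noD d dD; rewrite E dx.
Qed.

Lemma first_return_norb (H : finType) (X D : {set H}) (r s : {perm H}) :
    D \subset X -> first_return D r s -> meets_orbits X D r ->
  norb s D = norb r X.
Proof.
move=> DX ret met; rewrite /norb.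
have -> : porbit r @: X = porbit r @: D.
  apply/eqP; rewrite eqEsubset (imsetS _ DX) andbT; apply/subsetP => _ /imsetP[x xX ->].
  have [d dD] := met x xX; rewrite porbit_sym -eq_porbit_mem => /eqP->.
  exact: imset_f.
apply: card_imset_ker => x y xD yD.
by rewrite !eq_porbit_mem; apply: (first_return_porbit ret).
Qed.

(** Erasing the marks changes neither the number of vertices and faces nor the
    connectedness, provided that each vertex carries a half-edge. *)
Lemma maps_first_return (H : finType) (X D : {set H}) (r s : {perm H}) (g : nat) :
    stable r X -> D \subset X -> first_return D r s -> meets_orbits X D r ->
  maps X r D g = maps D s D g.
Proof.
move=> rX DX ret met; apply/setP => o; rewrite !inE.
have [oD /=|//] := boolP (matching D o).
rewrite (first_return_norb DX ret met).
rewrite (first_return_norb DX (first_return_matching oD ret) (meets_orbits_matching oD met)).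
congr (_ && _); have oX := matching_stable oD DX; have [sD _] := ret.
apply/transitiveP/transitiveP => tr Y.
  move=> YD /set0Pn[y0 y0Y] sY oY.
  pose W := [set x in X | [exists y in Y, y \in porbit r x]].
  have YW : Y \subset W.
    apply/subsetP => y yY; rewrite inE (subsetP DX) ?(subsetP YD) //=.
    by apply/exists_inP; exists y => //; apply: porbit_id.
  have DW : D :&: W \subset Y.
    apply/subsetP => d; rewrite !inE => /and3P[dD dX /exists_inP[y yY]].
    rewrite -(first_return_porbit ret) // ?(subsetP YD) // => yd.
    by rewrite -(porbit_stable sY yd).
  have WX : W = X.
    apply: tr; first by apply/subsetP => x; rewrite inE => /andP[].
    - by apply/set0Pn; exists y0; apply: (subsetP YW).
    - apply: stable_sub => x; rewrite !inE (stableP _ _ rX) => /andP[-> /=].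
      case/exists_inP=> y yY yx; apply/exists_inP; exists y => //.
      by rewrite -(porbit_perm r 1 x) expg1 in yx.
    apply: stable_sub => x xW; have [xD|/(matching_fix oD)-> //] := boolP (x \in D).
    apply: (subsetP YW); rewrite (stableP _ _ oY); apply: (subsetP DW).
    by rewrite inE xD.
  apply/eqP; rewrite eqEsubset YD /=; apply: subset_trans DW.
  by rewrite WX subsetI subxx.
move=> YX /set0Pn[y yY] rY oY.
have YD : Y :&: D = D.
  apply: tr; rewrite ?subsetIr //.
  - have [d dD dy] := met y (subsetP YX y yY).
    by apply/set0Pn; exists d; rewrite inE dD (porbit_stable rY dy) yY.
  - apply: stable_sub => x; rewrite !inE => /andP[xY xD].
    have sxD : s x \in D by have /stableP -> := sD.
    have xs : s x \in porbit s x by rewrite -[s]expg1 mem_porbit.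
    by rewrite (first_return_porbit ret) // in xs; rewrite (porbit_stable rY xs) xY.
  by apply: stableI => //; apply: matching_stable (subxx D).
apply/eqP; rewrite eqEsubset YX; apply/subsetP => x xX.
have [d dD dx] := met x xX; rewrite -(porbit_stable rY dx).
by move: dD; rewrite -YD inE => /andP[].
Qed.

(** * Transport along a bijection *)

Lemma perm_pull (S T : finType) (f : S -> T) (D : {set T}) (s : {perm T}) :
    injective f -> f @: setT = D -> stable s D ->
  exists r : {perm S}, forall x, f (r x) = s (f x).
Proof.
move=> f_inj fD sD; pose r x := odflt x [pick y | f y == s (f x)].
have rE x : f (r x) = s (f x).
  rewrite /r; case: pickP => [y /eqP //|no].
  have : s (f x) \in D by rewrite (stableP _ _ sD) -fD imset_f.
  by rewrite -fD => /imsetP[y _ E]; have := no y; rewrite E eqxx.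
have r_inj : injective r by move=> x y E; apply/f_inj/(@perm_inj _ s); rewrite -!rE E.
by exists (perm r_inj) => x; rewrite permE rE.
Qed.

Lemma perm_push (S T : finType) (f : S -> T) (r : {perm S}) :
    injective f ->
  exists s : {perm T}, (forall x, s (f x) = f (r x)) /\
    (forall y, y \notin f @: setT -> s y = y).
Proof.
move=> f_inj; pose s y := if [pick x | f x == y] is Some x then f (r x) else y.
have sE x : s (f x) = f (r x).
  by rewrite /s; case: pickP => [z /eqP/f_inj -> //|/(_ x)]; rewrite eqxx.
have sN y : y \notin f @: setT -> s y = y.
  by rewrite /s; case: pickP => // z /eqP <-; rewrite imset_f.
have s_inj : injective s.
  have im y : s y \in f @: setT = (y \in f @: setT).
    have [/imsetP[x _ ->]|yN] := boolP (y \in f @: setT); first by rewrite sE imset_f.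
    by rewrite sN // (negPf yN).
  move=> y z E; have [yf|yf] := boolP (y \in f @: setT).
    have := yf; rewrite -im E im => /imsetP[x' _ zx']; case/imsetP: yf => x _ yx.
    by move: E; rewrite yx zx' !sE => /f_inj/perm_inj->.
  by have := yf; rewrite -im E im => zf; rewrite !sN in E.
by exists (perm s_inj); split=> [x|y yN]; rewrite permE ?sE ?sN.
Qed.

Lemma porbit_transport (S T : finType) (f : S -> T) (r : {perm S}) (s : {perm T}) :
  (forall x, f (r x) = s (f x)) -> forall x, porbit s (f x) = f @: porbit r x.
Proof.
move=> fr x; have it i : f ((r ^+ i)%g x) = (s ^+ i)%g (f x).
  by rewrite !permX; elim: i => //= i <-; rewrite fr.
apply/setP => y; apply/porbitP/imsetP => [[i ->]|[_ /porbitP[i ->] ->]].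
  by exists ((r ^+ i)%g x); rewrite ?mem_porbit.
by exists i.
Qed.

Lemma norb_transport (S T : finType) (f : S -> T) (r : {perm S}) (s : {perm T}) :
  injective f -> (forall x, f (r x) = s (f x)) -> norb r setT = norb s (f @: setT).
Proof.
move=> f_inj fr; have fp := porbit_transport fr.
rewrite /norb -imset_comp (eq_imset _ fp) (imset_comp (fun Z : {set S} => f @: Z)).
by rewrite [RHS]card_imset //; apply: imset_inj.
Qed.

Lemma maps_transport (S T : finType) (f : S -> T) (D : {set T})
    (r o : {perm S}) (s p : {perm T}) (g : nat) :
    injective f -> f @: setT = D ->
    (forall x, f (r x) = s (f x)) -> (forall x, f (o x) = p (f x)) ->
    (forall y, y \notin D -> p y = y) ->
  (o \in maps setT r setT g) = (p \in maps D s D g).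
Proof.
move=> f_inj fD fr fo pN; rewrite !inE.
have fx x : f x \in D by rewrite -fD imset_f.
have -> : matching setT o = matching D p.
  apply/matchingP/matchingP => -[oK oD]; split=> y.
  - have [yD|yN] := boolP (y \in D); last by rewrite !pN.
    by move: yD; rewrite -fD => /imsetP[x _ ->]; rewrite -!fo oK.
  - have [yD|yN] := boolP (y \in D); last by rewrite pN ?eqxx.
    by move: yD; rewrite -fD => /imsetP[x _ ->]; rewrite -!fo (inj_eq f_inj) oD inE.
  - by apply: f_inj; rewrite !fo oK.
  by rewrite inE -(inj_eq f_inj) fo oD fx.
have -> : transitive_on setT r o = transitive_on D s p.
  apply/transitiveP/transitiveP => tr Y.
    move=> YD /set0Pn[y yY] /stableP sY /stableP pY.
    have E : [set x | f x \in Y] = setT.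
      apply: tr; rewrite ?subsetT //.
      - move: (subsetP YD y yY); rewrite -fD => /imsetP[x _ yx].
        by apply/set0Pn; exists x; rewrite inE -yx.
      - by apply/stableP => x; rewrite !inE fr.
      by apply/stableP => x; rewrite !inE fo.
    apply/eqP; rewrite eqEsubset YD -fD; apply/subsetP => _ /imsetP[x xT ->].
    by move: xT; rewrite -E inE.
  move=> _ /set0Pn[x xY] /stableP rY /stableP oY.
  have E : f @: Y = D.
    apply: tr; first by rewrite -fD imsetS ?subsetT.
    - by apply/set0Pn; exists (f x); rewrite imset_f.
    - by apply: stable_sub => _ /imsetP[z zY ->]; rewrite -fr imset_f // rY.
    by apply: stable_sub => _ /imsetP[z zY ->]; rewrite -fo imset_f // oY.
  by apply: (imset_inj f_inj); rewrite E.
have -> : norb r setT = norb s D by rewrite -fD; apply: norb_transport.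
have -> : norb (o * r)%g setT = norb (p * s)%g D.
  by rewrite -fD; apply: norb_transport => // x; rewrite !permM fr fo.
by rewrite -fD card_imset.
Qed.

Lemma card_maps_transport (S T : finType) (f : S -> T) (D : {set T})
    (r : {perm S}) (s : {perm T}) (g : nat) :
    injective f -> f @: setT = D -> (forall x, f (r x) = s (f x)) ->
  #|maps setT r setT g| = #|maps D s D g|.
Proof.
move=> f_inj fD fr; rewrite -[LHS]muln1 -[RHS]muln1.
pose R (o : {perm S}) (p : {perm T}) := [forall x, f (o x) == p (f x)].
apply: (double_count (R := R)) => [o oM|p pM]; apply/eqP/cards1P.
  have [p [pE pN]] := perm_push o f_inj; rewrite fD in pN; exists p.
  apply/setP => q; rewrite !inE; apply/andP/eqP => [[qM /'forall_eqP Rq]|->]; last first.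
    split; last by apply/'forall_eqP.
    by have := maps_transport g f_inj fD fr (fun x => esym (pE x)) pN; rewrite oM !inE.
  have {qM} qD : matching D q by case/and3P: qM.
  apply/permP => y; have [yD|yN] := boolP (y \in D).
    by move: yD; rewrite -fD => /imsetP[x _ ->]; rewrite pE Rq.
  by rewrite pN // (matching_fix qD).
have pD : matching D p by move: pM; rewrite inE => /and3P[].
have [o oE] := perm_pull f_inj fD (matching_stable pD (subxx D)); exists o.
apply/setP => q; rewrite !inE; apply/andP/eqP => [[qM /'forall_eqP Rq]|->].
  by apply/permP => x; apply: f_inj; rewrite Rq oE.
split; last by apply/'forall_eqP.
have := maps_transport g f_inj fD fr oE (fun y => @matching_fix _ _ _ y pD).
by rewrite pM !inE.
Qed.

(** * Cell graphs as maps *)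

Definition vertex_cycles (H : finType) (n : nat) (r : {perm H}) (w : H -> 'I_n) : bool :=
  [forall h, forall h', (w h == w h') == (h' \in porbit r h)].

Lemma vertex_cyclesP (H : finType) (n : nat) (r : {perm H}) (w : H -> 'I_n) :
  reflect (forall h h', (w h == w h') = (h' \in porbit r h)) (vertex_cycles r w).
Proof.
apply: (iffP forallP) => [h x y|h x]; first by have /forallP/(_ y)/eqP := h x.
by apply/forallP => y; rewrite h.
Qed.

Lemma norb_fibres (H : finType) (n : nat) (r : {perm H}) (w : H -> 'I_n) :
  vertex_cycles r w -> (forall i, exists h, w h = i) -> norb r setT = n.
Proof.
move=> /vertex_cyclesP wr surj; rewrite /norb (@card_imset_ker _ _ _ _ w) => [|x y _ _].
  rewrite -[RHS]card_ord -cardsT; congr #|pred_of_set _|.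
  by apply/setP => i; rewrite inE; have [h <-] := surj i; rewrite imset_f.
by rewrite eq_porbit_mem porbit_sym wr.
Qed.

(** The cycles of a fixed-point free involution all have two elements. *)
Lemma norb_matching (H : finType) (o : {perm H}) :
  matching setT o -> 2 * #|porbits o| = #|H|.
Proof.
move=> oT.
have po : partition (porbits o) [set: H].
  apply/and3P; split.
  - apply/eqP/setP => x; rewrite inE; apply/bigcupP; exists (porbit o x).
      exact: imset_f.
    exact: porbit_id.
  - apply/trivIsetP => _ _ /imsetP[x _ ->] /imsetP[y _ ->]; apply: contraNT.
    case/pred0Pn => z /andP[/= zx zy]; move: zx zy; rewrite -!eq_porbit_mem.
    by move=> /eqP <- /eqP <-.
  apply/imsetP => -[x _ E]; have := porbit_id o x.
  by rewrite -E inE.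
rewrite -[RHS]cardsT (card_uniform_partition _ po (n := 2)) 1?mulnC // => _ /imsetP[x _ ->].
have -> : porbit o x = [set x; o x].
  apply/setP => y; rewrite !inE; apply/porbitP/orP => [[i ->]|[]/eqP->].
  - rewrite permX; elim: i => [|i] /=; first by left.
    by case=> /eqP->; [right | left; rewrite (matching_invol x oT)].
  - by exists 0; rewrite expg0 perm1.
  by exists 1; rewrite expg1.
by rewrite cards2 eq_sym (matching_neq oT) ?inE.
Qed.

Lemma connected_transitive (H : finType) (n : nat) (G : cell_data H n) :
    matching setT (opposite G) -> vertex_cycles (rotation G) (vertex G) ->
    (forall i, exists h, vertex G h = i) ->
  [forall i, forall j, connect (adjacent G) i j]
    = transitive_on setT (rotation G) (opposite G).
Proof.
move=> oG /vertex_cyclesP wG surj; apply/forallP/transitiveP => [con Y _|tr i].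
  move=> /set0Pn[y yY] rY oY; apply/setP => x; rewrite inE.
  have cl : closed (adjacent G) [set vertex G h | h in Y].
    have step i j : adjacent G i j -> i \in [set vertex G h | h in Y] ->
        j \in [set vertex G h | h in Y].
      case/existsP => h /andP[/eqP <- /eqP <-] /imsetP[z zY /eqP].
      rewrite eq_sym wG => hz; apply: imset_f.
      by rewrite (stableP _ _ oY) (porbit_stable rY hz).
    move=> i j ij; apply/idP/idP; apply: step => //.
    case/existsP: ij => h /andP[/eqP <- /eqP <-]; apply/existsP; exists (opposite G h).
    by rewrite (matching_invol h oG) !eqxx.
  have := closed_connect cl (forallP (con (vertex G y)) (vertex G x)).
  rewrite imset_f // => /esym/imsetP[z zY /eqP]; rewrite eq_sym wG => zx.
  by rewrite (porbit_stable rY zx).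
apply/forallP => j; have [hi <-] := surj i; have [hj <-] := surj j.
have E : [set x | connect (adjacent G) (vertex G hi) (vertex G x)] = setT.
  apply: tr; rewrite ?subsetT //.
  - by apply/set0Pn; exists hi; rewrite inE connect0.
  - apply: stable_sub => x; rewrite !inE; suff -> : vertex G (rotation G x) = vertex G x by [].
    by apply/eqP; rewrite eq_sym wG -{1}[rotation G]expg1 mem_porbit.
  apply: stable_sub => x; rewrite !inE => /connect_trans; apply; apply: connect1.
  by apply/existsP; exists x; rewrite !eqxx.
by have := in_setT hj; rewrite -E inE.
Qed.

(** With all degrees positive every vertex is a cycle of the rotation, so that
    the vertex labels only enter through the first condition. *)
Lemma is_cell_graphE (H : finType) (n g : nat) (G : cell_data H n) :
    (forall i, 0 < degree G i) ->
  is_cell_graph g G = vertex_cycles (rotation G) (vertex G)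
                      && (opposite G \in maps setT (rotation G) setT g).
Proof.
move=> dG; have surj i : exists h, vertex G h = i.
  by have := dG i; rewrite card_gt0 => /set0Pn[h]; rewrite inE => /eqP <-; exists h.
rewrite /is_cell_graph -/(vertex_cycles _ _) inE.
have -> : [forall h, (opposite G h != h) && (opposite G (opposite G h) == h)]
          = matching setT (opposite G).
  by apply: eq_forallb => h; rewrite inE andbC eqb_id.
have [oT|] := boolP (matching setT (opposite G)); last by rewrite !andbF.
have [wG|//] := boolP (vertex_cycles _ _); rewrite /= connected_transitive //.
congr (_ && _); rewrite (norb_fibres wG surj) norbT /face_perm cardsT -(norb_matching oT).
move: #|porbits (opposite G)| => a; move: #|porbits _| => b.
by apply/eqP/eqP; clear; lia.
Qed.

Lemma degree_iso (H : finType) (n : nat) (G G' : cell_data H n) (f : {perm H}) :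
  is_cell_iso G G' f -> degree G' =1 degree G.
Proof.
move=> /forallP iso i; rewrite /degree -[RHS](card_imset _ (@perm_inj _ f)).
apply: eq_card => h; apply/idP/imsetP => [|[h' + ->]].
  rewrite inE => hi; exists ((f^-1)%g h); rewrite ?permKV // inE.
  by have /and3P[_ _ /eqP ->] := iso ((f^-1)%g h); rewrite permKV.
by rewrite !inE; have /and3P[_ _ /eqP ->] := iso h'.
Qed.

Lemma is_cell_graph_iso (H : finType) (n g : nat) (G G' : cell_data H n) (f : {perm H}) :
    (forall i, 0 < degree G i) ->
  is_cell_iso G G' f -> is_cell_graph g G -> is_cell_graph g G'.
Proof.
move=> dG iso; have dE := degree_iso iso.
rewrite !is_cell_graphE // => [|i]; last by rewrite dE.
have fr x : f (rotation G x) = rotation G' (f x).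
  by have /forallP/(_ x)/and3P[/eqP ? _ _] := iso.
have fo x : f (opposite G x) = opposite G' (f x).
  by have /forallP/(_ x)/and3P[_ /eqP ? _] := iso.
have fw x : vertex G' (f x) = vertex G x.
  by have /forallP/(_ x)/and3P[_ _ /eqP ->] := iso.
have f_inj := @perm_inj _ f.
have fT : f @: setT = setT.
  by apply/setP => y; rewrite inE -(permKV f y) imset_f.
move=> /andP[/vertex_cyclesP wG oG]; apply/andP; split.
  apply/vertex_cyclesP => x y; rewrite -(permKV f x) -(permKV f y) !fw wG.
  by rewrite (porbit_transport fr) mem_imset.
by rewrite -(maps_transport g f_inj fT fr fo) // => y; rewrite inE.
Qed.

Lemma is_cell_iso_mul (H : finType) (n : nat) (G1 G2 G3 : cell_data H n) (f h : {perm H}) :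
  is_cell_iso G1 G2 f -> is_cell_iso G2 G3 h -> is_cell_iso G1 G3 (f * h)%g.
Proof.
move=> /forallP hf /forallP hh; apply/forallP => x; rewrite !permM.
have /and3P[/eqP-> /eqP-> /eqP->] := hf x.
by have /and3P[/eqP-> /eqP-> /eqP->] := hh (f x); rewrite !eqxx.
Qed.

Lemma is_cell_isoV (H : finType) (n : nat) (G1 G2 : cell_data H n) (f : {perm H}) :
  is_cell_iso G1 G2 f -> is_cell_iso G2 G1 (f^-1)%g.
Proof.
move=> /forallP hf; apply/forallP => x; have /and3P[/eqP a /eqP b /eqP c] := hf ((f^-1)%g x).
by rewrite permKV in a b c; rewrite -a -b c !permK !eqxx.
Qed.

Lemma cell_isog_equiv (H : finType) (n : nat) : equivalence_rel (@cell_isog H n).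
Proof.
have refl G : cell_isog G G.
  by apply/existsP; exists 1%g; apply/forallP => x; rewrite !perm1 !eqxx.
have sym G1 G2 : cell_isog G1 G2 -> cell_isog G2 G1.
  by case/existsP => f /is_cell_isoV iso; apply/existsP; exists (f^-1)%g.
have trans G1 G2 G3 : cell_isog G1 G2 -> cell_isog G2 G3 -> cell_isog G1 G3.
  move=> /existsP[f hf] /existsP[h hh]; apply/existsP; exists (f * h)%g.
  exact: is_cell_iso_mul hf hh.
move=> x y z; split=> // xy; apply/idP/idP; apply: trans => //.
exact: sym.
Qed.

(** Orbit-stabiliser for the relabellings of the half-edges: each of them
    carries G to exactly one graph, and those leading to a given isomorphic graph
    form a coset of the automorphism group. *)
Lemma card_cell_class (g : nat) (mu : seq nat)
    (G : cell_data 'I_(sumn mu) (size mu)) :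
    0 \notin mu -> G \in cell_graphs g mu ->
  #|[set G' in cell_graphs g mu | cell_isog G G']| * #|cell_aut G| = (sumn mu)`!.
Proof.
move=> mu0 Gin; have := Gin; rewrite inE => /andP[cG /forallP dG].
have dG0 i : 0 < degree G i.
  by rewrite (eqP (dG i)) lt0n; apply: contraNneq mu0 => <-; apply: mem_nth.
have -> : (sumn mu)`! = #|[set: {perm 'I_(sumn mu)}]| * 1.
  by rewrite muln1 cardsT; apply/esym/card_Sn.
apply: (double_count (R := fun G' f => is_cell_iso G G' f)) => [G'|f _].
  rewrite inE => /andP[_ /existsP[f0 iso0]].
  rewrite -[RHS](card_imset _ (mulIg f0)); apply: eq_card => f.
  apply/idP/imsetP => [|[a + ->]]; rewrite !inE /=.
    move=> iso; exists (f * f0^-1)%g; last by rewrite mulgKV.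
    by rewrite inE; apply: is_cell_iso_mul iso (is_cell_isoV iso0).
  by move/is_cell_iso_mul; apply.
apply/eqP/cards1P.
pose G' : cell_data 'I_(sumn mu) (size mu) :=
  ((rotation G ^ f)%g, (opposite G ^ f)%g, [ffun h => vertex G ((f^-1)%g h)]).
have iso : is_cell_iso G G' f.
  by apply/forallP => x; rewrite /rotation /opposite /vertex /= !permJ ffunE permK !eqxx.
exists G'; apply/setP => G2; rewrite !inE; apply/idP/eqP => [/andP[_ /forallP iso2]|->].
  case: G2 iso2 => [[r2 o2] w2]; rewrite /is_cell_iso /rotation /opposite /vertex /= => iso2.
  have i2 x := iso2 ((f^-1)%g x).
  congr (_, _, _); last apply/ffunP => x; try apply/permP => x;
    have /and3P[/eqP a /eqP b /eqP c] := i2 x; rewrite permKV in a b c.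
  - by rewrite -a -{2}(permKV f x) permJ.
  - by rewrite -b -{2}(permKV f x) permJ.
  by rewrite ffunE -c.
rewrite (is_cell_graph_iso dG0 iso cG) iso andbT /=; apply/andP; split.
  by apply/forallP => i; rewrite (degree_iso iso).
by apply/existsP; exists f.
Qed.

(** Counting isomorphism classes with weight 1/Aut amounts to counting labelled
    graphs and dividing by the number of labellings. *)
Lemma cell_countE (g : nat) (mu : seq nat) :
  0 \notin mu -> (cell_count g mu * (sumn mu)`!%:R = #|cell_graphs g mu|%:R)%R.
Proof.
move=> mu0; rewrite /cell_count; set D := cell_graphs g mu.
have eqv : {in D & &, equivalence_rel (@cell_isog 'I_(sumn mu) (size mu))}.
  by move=> x y z _ _ _; apply: cell_isog_equiv.
have part := equivalence_partitionP eqv; rewrite -/(cell_classes g mu) in part *.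
have tr := transversalP part; set X := transversal _ _ in tr *.
rewrite (card_partition part) -(pblock_transversal tr) (big_imset _ (pblock_inj tr)) /=.
rewrite GRing.mulr_suml GRing.natr_sum; apply: eq_bigr => G /(subsetP (transversal_sub tr)) GD.
have -> : pblock (cell_classes g mu) G = [set G' in D | cell_isog G G'].
  have [_ tiP _] := and3P part; apply: def_pblock => //; first exact: imset_f.
  by rewrite in_set GD; case: (cell_isog_equiv G G G).
have aut0 : (#|cell_aut G|%:R != 0 :> rat)%R.
  rewrite Num.Theory.pnatr_eq0 -lt0n; apply/card_gt0P; exists 1%g; rewrite inE.
  by apply/forallP => x; rewrite !perm1 !eqxx.
by rewrite -(card_cell_class mu0 GD) GRing.natrM GRing.mulrC GRing.mulfK.
Qed.

(** * Counting maps with prescribed vertex degrees *)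

Lemma expg_porbit (H : finType) (r : {perm H}) (x : H) (i j : nat) :
  ((r ^+ i)%g x == (r ^+ j)%g x) = (i == j %[mod #|porbit r x|]).
Proof.
set c := #|porbit r x|; have c0 : 0 < c by rewrite lt0n card_porbit_neq0.
have red k : (r ^+ k)%g x = iter (k %% c) r x.
  rewrite permX {1}(divn_eq k c) addnC iterD; congr iter.
  by elim: (k %/ c) => //= m IH; rewrite mulSn iterD IH iter_porbit.
rewrite !red; apply/eqP/eqP => [E|-> //].
have := uniq_traject_porbit r x; rewrite -/c => /(nth_uniq x) U.
have := U (i %% c) (j %% c); rewrite size_traject !ltn_mod => /(_ c0 c0).
by rewrite !nth_traject ?ltn_mod // E eqxx => /esym/eqP.
Qed.

Lemma expg_porbit_eq (S T : finType) (r : {perm S}) (s : {perm T}) (x : S) (y : T) (i j : nat) :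
    #|porbit r x| = #|porbit s y| ->
  ((r ^+ i)%g x == (r ^+ j)%g x) = ((s ^+ i)%g y == (s ^+ j)%g y).
Proof. by move=> E; rewrite !expg_porbit E. Qed.

(** Such a conjugation is determined by the images of one base point in each
    cycle, and these can be chosen freely in the cycles with the same label. This
    is why marking one half-edge at every vertex kills all automorphisms. *)
Lemma card_conjugations (S T : finType) (n : nat) (D : {set T}) (m : 'I_n -> nat)
    (r : {perm S}) (w : S -> 'I_n) (s : {perm T}) (v : T -> 'I_n) :
    (forall i, 0 < m i) -> stable s D ->
    vertex_cycles r w -> (forall i, #|[set x | w x == i]| = m i) ->
    {in D &, forall x y, (v x == v y) = (y \in porbit s x)} ->
    (forall i, #|[set y in D | v y == i]| = m i) ->
  #|[set f : {ffun S -> T} | [&& injectiveb f, [forall x, f x \in D],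
      [forall x, f (r x) == s (f x)] & [forall x, v (f x) == w x]]]|
  = \prod_i m i.
Proof.
move=> m0 sD /vertex_cyclesP rw cw sv cv.
have [a aP] : exists a : 'I_n -> S, forall i, w (a i) = i.
  have /fin_all_exists [a aP] : forall i, exists x, w x = i.
    by move=> i; have := m0 i; rewrite -cw => /card_gt0P[x]; rewrite inE => /eqP; exists x.
  by exists a.
have ca i : #|porbit r (a i)| = m i.
  by rewrite -cw; apply: eq_card => x; rewrite inE -rw aP eq_sym.
have cb y : y \in D -> #|porbit s y| = m (v y).
  move=> yD; rewrite -cv; apply: eq_card => z; rewrite inE.
  apply/idP/andP => [zy|[zD]]; last by rewrite eq_sym sv.
  have zD : z \in D by rewrite (porbit_stable sD zy).
  by rewrite zD eq_sym sv.
have kP x : exists k, x = (r ^+ k)%g (a (w x)) by apply/porbitP; rewrite -rw aP.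
have /fin_all_exists [k {}kP] := kP.
pose F i := [set y in D | v y == i].
transitivity #|setXn F|; last by rewrite cardsXn; apply: eq_bigr => i _; rewrite cv.
pose ev (f : {ffun S -> T}) : {dffun forall i : 'I_n, T} := [ffun i => f (a i)].
set E := [set f | _].
have EP f : f \in E -> [/\ injective f, forall x, f x \in D,
    forall x, f (r x) = s (f x) & forall x, v (f x) = w x].
  rewrite inE => /and4P[/injectiveP ? /forallP ? /'forall_eqP ? /'forall_eqP ?].
  by [].
have fk f : f \in E -> forall x, f x = (s ^+ k x)%g (f (a (w x))).
  move=> /EP[_ _ fr _] x; rewrite {1}(kP x) !permX.
  by elim: (k x) => //= i <-; rewrite fr.
rewrite -(@card_in_imset _ _ ev E) => [|f h fE hE ev_eq]; last first.
  apply/ffunP => x; rewrite (fk f) // (fk h) //; congr (fun_of_perm _ _).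
  by have := congr1 (fun u : {dffun forall i : 'I_n, T} => u (w x)) ev_eq; rewrite !ffunE.
apply: eq_card => b; rewrite in_setXn; apply/imsetP/forallP => [[f /EP[_ fD _ fv] ->] i|bF].
  by rewrite !inE ffunE fD fv aP eqxx.
have bD i : b i \in D by have := bF i; rewrite inE => /andP[].
have bv i : v (b i) = i by have := bF i; rewrite inE => /andP[_ /eqP].
have cab i : #|porbit r (a i)| = #|porbit s (b i)| by rewrite ca cb ?bv.
pose f : {ffun S -> T} := [ffun x => (s ^+ k x)%g (b (w x))].
have fD x : f x \in D by rewrite ffunE (porbit_stable sD (mem_porbit _ _ _)).
have fv x : v (f x) = w x.
  by rewrite -[RHS]bv; apply/eqP; rewrite eq_sym sv // ffunE mem_porbit.
exists f; last first.
  apply/ffunP => i; rewrite !ffunE aP; apply/esym/eqP.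
  have : (r ^+ k (a i))%g (a i) == (r ^+ 0)%g (a i) by rewrite -{2}(aP i) -kP expg0 perm1.
  by rewrite (expg_porbit_eq _ _ (cab i)) expg0 perm1.
have wr x : w (r x) = w x by apply/esym/eqP; rewrite rw -{1}[r]expg1 mem_porbit.
rewrite inE; apply/and4P; split.
- apply/injectiveP => x y fxy; have wxy : w x = w y by rewrite -!fv fxy.
  apply/eqP; rewrite (kP x) (kP y) -wxy (expg_porbit_eq _ _ (cab (w x))).
  by move: fxy; rewrite !ffunE -wxy => ->.
- exact/forallP.
- apply/forallP => x; rewrite !ffunE wr -permM -expgSr.
  rewrite -(expg_porbit_eq _ _ (cab (w x))) -{1}wr -kP expgSr permM -kP //.
by apply/forallP => x; rewrite fv.
Qed.

(** Double counting of the pairs formed by a labelled cell graph G and a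
    bijection f from its half-edges to D that carries the rotation of G to s: for
    given G there are as many f as systems of arrows on G, while a given f
    leaves the choice of the edges, that is of a map with rotation s. *)
Lemma card_cell_graphs_maps (T : finType) (mu : seq nat) (g : nat) (D : {set T})
    (s : {perm T}) (v : T -> 'I_(size mu)) :
    0 \notin mu -> stable s D ->
    {in D &, forall x y, (v x == v y) = (y \in porbit s x)} ->
    (forall i, #|[set y in D | v y == i]| = nth 0 mu i) ->
  #|cell_graphs g mu| * \prod_(m <- mu) m = (sumn mu)`! * #|maps D s D g|.
Proof.
move=> mu0 sD sv cv.
have mpos (i : 'I_(size mu)) : 0 < nth 0 mu i.
  by rewrite lt0n; apply: contraNneq mu0 => <-; apply: mem_nth.
have cD : #|D| = sumn mu.
  rewrite sumnE (big_nth 0) big_mkord -sum1_card (partition_big v predT) //=.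
  by apply: eq_bigr => i _; rewrite -cv -sum1_card; apply: eq_bigl => y; rewrite inE.
pose B := [set f : {ffun 'I_(sumn mu) -> T} in ffun_on D | injectiveb f].
have -> : (sumn mu)`! = #|B| by rewrite card_inj_ffuns_on card_ord cD ffactnn.
pose R (G : cell_data 'I_(sumn mu) (size mu)) (f : {ffun 'I_(sumn mu) -> T}) :=
  [forall x, f (rotation G x) == s (f x)] && [forall x, v (f x) == vertex G x].
have -> : \prod_(m <- mu) m = \prod_(i < size mu) nth 0 mu i.
  by rewrite (big_nth 0) big_mkord.
apply: (double_count (R := R)) => [G|f].
  rewrite inE => /andP[cG /'forall_eqP dG].
  have dG0 i : 0 < degree G i by rewrite dG.
  move: cG; rewrite is_cell_graphE // => /andP[wG _].
  rewrite -(card_conjugations mpos sD wG dG sv cv).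
  apply: eq_card => f; rewrite /R 3!in_set [RHS]andbA [injectiveb f && _]andbC.
  by congr [&& (_ && _), _ & _]; apply/ffun_onP/forallP.
rewrite inE => /andP[/ffun_onP fD /injectiveP f_inj].
have fT : f @: setT = D.
  apply/eqP; rewrite eqEcard card_imset // cardsT card_ord cD leqnn andbT.
  by apply/subsetP => _ /imsetP[x _ ->]; apply: fD.
have [r rE] := perm_pull f_inj fT sD.
rewrite -(card_maps_transport g f_inj fT rE).
set A := [set G in _ | _].
have AP G : G \in A -> rotation G = r /\ (forall x, vertex G x = v (f x)).
  rewrite inE => /and3P[_ /'forall_eqP Gr /'forall_eqP Gv]; split=> //.
  by apply/permP => x; apply: f_inj; rewrite Gr rE.
rewrite -(@card_in_imset _ _ (fun G => opposite G) A) => [|G1 G2 G1A G2A oE]; last first.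
  have [r1 v1] := AP _ G1A; have [r2 v2] := AP _ G2A.
  case: G1 G2 oE r1 v1 r2 v2 {G1A G2A} => [[a1 b1] c1] [[a2 b2] c2].
  rewrite /opposite /rotation /vertex /= => -> -> v1 -> v2.
  by congr (_, _, _); apply/ffunP => x; rewrite v1 v2.
have wr : vertex_cycles r (fun x => v (f x)).
  apply/vertex_cyclesP => x y; rewrite sv //.
  by rewrite (porbit_transport rE) mem_imset.
have dg i : #|[set x | v (f x) == i]| = nth 0 mu i.
  rewrite -cv -(card_imset _ f_inj); apply: eq_card => y.
  rewrite [in RHS]inE -fT; apply/imsetP/andP => [[x + ->]|[/imsetP[x _ ->] vx]].
    by rewrite inE => ->; rewrite imset_f.
  by exists x; rewrite ?inE.
apply: eq_card => o; apply/imsetP/idP => [[G GA ->]|oM].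
  have [Gr Gv] := AP _ GA; move: GA; rewrite !in_set => /andP[/andP[cG /'forall_eqP dG] _].
  move: cG; rewrite is_cell_graphE => [|i]; last by rewrite dG.
  by rewrite Gr inE => /andP[].
exists (r, o, [ffun x => v (f x)]) => //.
rewrite in_set [_ \in cell_graphs _ _]in_set /R /rotation /vertex /=.
have dG i : degree ((r, o, [ffun x => v (f x)]) : cell_data _ _) i = nth 0 mu i.
  by rewrite -dg; apply: eq_card => x; rewrite !inE /vertex /= ffunE.
rewrite is_cell_graphE => [|i]; last by rewrite dG.
rewrite /rotation /opposite /= oM andbT -!andbA; apply/and4P; split.
- by apply/vertex_cyclesP => x y; rewrite /vertex /= !ffunE; exact: (elimT (vertex_cyclesP _ _) wr).
- by apply/'forall_eqP.
- by apply/'forall_eqP.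
by apply/'forall_eqP => x; rewrite ffunE.
Qed.

Lemma maps_isolated_vertex (T : finType) (X D : {set T}) (r : {perm T}) (g : nat) :
    stable r X -> D = set0 -> X != set0 -> {in X &, forall x y, y \in porbit r x} ->
  #|maps X r D g| = (g == 0).
Proof.
move=> rX -> /set0Pn[x xX] one.
have nX : norb r X = 1.
  apply/eqP/cards1P; exists (porbit r x); apply/setP => C; rewrite inE.
  apply/imsetP/eqP => [[y yX ->]|->]; last by exists x.
  by apply/eqP; rewrite eq_porbit_mem one.
have tr : transitive_on X r 1%g.
  apply/transitiveP => Y YX /set0Pn[y yY] rY _; apply/eqP; rewrite eqEsubset YX.
  by apply/subsetP => z zX; rewrite (porbit_stable rY (one y z (subsetP YX y yY) zX)).
have m1 : matching set0 (1%g : {perm T}) by rewrite matching0.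
case: g => [|g] /=; last first.
  apply/eqP; rewrite cards_eq0 -subset0; apply/subsetP => o; rewrite !inE matching0.
  by case/and3P => /eqP -> _; rewrite mul1g nX cards0 /=; lia.
apply/eqP/cards1P; exists 1%g; apply/setP => o; rewrite !inE matching0.
by case: eqP => [->|] //=; rewrite tr mul1g nX cards0.
Qed.

(** Degrees are read off from labels of the cycles, so that a cycle without any
    point of D still contributes an entry 0, and the order of the degrees can be
    prescribed by ts. *)
Definition labelled_by (T : finType) (L : eqType) (X : {set T}) (r : {perm T})
    (D : {set T}) (vt : T -> L) (ts : seq L) : Prop :=
  [/\ uniq ts, stable r X /\ D \subset X, {in X, forall x, vt x \in ts},
      {in ts, forall t, exists2 x, x \in X & vt x = t}
    & {in X &, forall x y, (vt x == vt y) = (y \in porbit r x)}].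

(** Arrowed cell graphs are maps with a fixed rotation. An entry 0 in the list of
    degrees is a cycle of marks, which disconnects the map unless it is all of X;
    this matches the convention on the values of catalan. *)
Theorem catalanE (T : finType) (L : eqType) (X : {set T}) (r : {perm T})
    (D : {set T}) (vt : T -> L) (ts : seq L) (g : nat) :
    labelled_by X r D vt ts -> ts != [::] ->
  catalan (Posz g) [seq #|[set x in D | vt x == t]| | t <- ts] = (#|maps X r D g|%:R)%R.
Proof.
move=> [uts [rX DX] vts tsv vr] ts0; set mu := map _ _.
have szmu : size mu = size ts by rewrite size_map.
have [x0 x0X] : exists x, x \in X.
  by case: ts ts0 tsv {szmu mu uts vts} => // t ts _ /(_ t (mem_head _ _))[x xX _]; exists x.
have X0 : X != set0 by apply/set0Pn; exists x0.
rewrite /catalan -/mu; have [mu0|mu0] := boolP (0 \in mu); last first.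
  have -> : (mu == [:: 0]) = false.
    by apply: contraNF mu0 => /eqP ->; rewrite inE.
  rewrite andbF.
  have [s ret] := first_return_exists D r; have [sD _] := ret.
  have met : meets_orbits X D r.
    move=> x xX; have : 0 < #|[set y in D | vt y == vt x]|.
      rewrite lt0n; apply: contraNneq mu0 => <-; apply/mapP; exists (vt x) => //.
      exact: vts.
    case/card_gt0P => y; rewrite inE => /andP[yD yx]; exists y => //.
    by rewrite -vr // 1?eq_sym // (subsetP DX).
  rewrite (maps_first_return g rX DX ret met).
  have i0P : 0 < size mu by rewrite szmu lt0n size_eq0.
  pose v y : 'I_(size mu) := insubd (Ordinal i0P) (index (vt y) ts).
  have vE y : y \in D -> v y = index (vt y) ts :> nat.
    move=> yD; by rewrite val_insubd ifT // szmu index_mem; apply/vts/(subsetP DX).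
  have sv : {in D &, forall x y, (v x == v y) = (y \in porbit s x)}.
    move=> x y xD yD; rewrite (first_return_porbit ret) // -vr ?(subsetP DX) //.
    rewrite -val_eqE /= !vE //; apply/eqP/eqP => [E|-> //].
    rewrite -(nth_index (vt x) (vts x (subsetP DX x xD))) E nth_index //.
    exact/vts/(subsetP DX).
  have cv i : #|[set y in D | v y == i]| = nth 0 mu i.
    have ilt : i < size ts by rewrite -szmu.
    have t0 := vt x0; rewrite (nth_map t0) //; apply: eq_card => y; rewrite !inE.
    have [yD /=|//] := boolP (y \in D); rewrite -val_eqE /= vE //.
    apply/eqP/eqP => [<-|->]; last by rewrite index_uniq.
    by rewrite nth_index //; apply/vts/(subsetP DX).
  have := card_cell_graphs_maps g mu0 sD sv cv; have := cell_countE g mu0.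
  move=> cE E; apply: (@GRing.mulIf _ ((sumn mu)`!%:R)%R).
    by rewrite Num.Theory.pnatr_eq0 -lt0n fact_gt0.
  rewrite -GRing.mulrA cE -!GRing.natrM [in LHS]mulnC E mulnC //.
have [mu1|mu1] := eqVneq mu [:: 0].
  have [t0 tsE] : exists t, ts = [:: t].
    by move: szmu; rewrite mu1; case: (ts) => [|t []] // _; exists t.
  have all_t0 x : x \in X -> vt x = t0 by move/vts; rewrite tsE inE => /eqP.
  have D0 : D = set0.
    apply/eqP; rewrite -cards_eq0; move: mu1; rewrite /mu tsE /= => -[<-].
    apply/eqP/eq_card => y; rewrite inE; case: (boolP (y \in D)) => //= yD.
    by rewrite all_t0 ?eqxx // (subsetP DX).
  rewrite maps_isolated_vertex // => [|x y xX yX]; last by rewrite -vr // !all_t0.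
  by rewrite andbT; case: (g == 0).
rewrite andbF; suff -> : #|maps X r D g| = 0 by [].
apply/eqP; rewrite cards_eq0 -subset0; apply/subsetP => o.
rewrite inE => /and3P[oD /transitiveP tr _].
case/mapP: mu0 => t tts /esym t0.
have noD x : x \in D -> vt x != t.
  move=> xD; apply/eqP => xt; have : x \in [set x in D | vt x == t] by rewrite inE xD xt /=.
  by move/eqP: t0; rewrite cards_eq0 => /eqP ->; rewrite inE.
pose Y := [set x in X | vt x == t].
have YX : Y = X.
  apply: tr.
  - by apply/subsetP => x; rewrite inE => /andP[].
  - by have [x xX xt] := tsv t tts; apply/set0Pn; exists x; rewrite inE xX xt /=.
  - apply: stable_sub => x; rewrite !inE => /andP[xX /eqP <-].
    by rewrite (stableP _ _ rX) xX /= eq_sym vr ?(stableP _ _ rX) // -{1}[r]expg1 mem_porbit.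
  apply: stable_sub => x; rewrite inE => /andP[xX xt]; rewrite (matching_fix oD) ?inE ?xX //.
  by apply: contraTN xt; apply: noD.
have allt t' : t' \in ts -> t' = t.
  by case/tsv => x; rewrite -YX inE => /andP[_ /eqP xt] <-.
case/eqP: mu1; move: uts allt t0; rewrite /mu; clear -ts0; case: ts ts0 => // t1 [|t2 ts] _ /=.
  by move=> _ /(_ t1 (mem_head _ _)) -> ->.
move=> /andP[]; rewrite inE negb_or => /andP[/eqP n12 _] _ h; case: n12.
have t2in : t2 \in [:: t1, t2 & ts] by rewrite !inE eqxx orbT.
by rewrite [RHS](h t2 t2in); apply: h; apply: mem_head.
Qed.

(** * Integrality *)

Lemma vertex_cycles_exist (n : nat) (m : 'I_n -> nat) :
  exists (H : finType) (r : {perm H}) (w : H -> 'I_n),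
    vertex_cycles r w /\ (forall i, #|[set x | w x == i]| = m i).
Proof.
pose H := {i : 'I_n & 'I_(m i)}.
pose f (x : H) : H := Tagged (fun i => 'I_(m i)) (ordS (tagged x)).
have f_inj : injective f.
  move=> [i a] [j b] /eqP; rewrite /f /= -tag_eqE /tag_eq /= => /andP[/eqP ij].
  case: j / ij b => b; rewrite tagged_asE => /eqP/(bij_inj (@ordS_bij _)) ->.
  by [].
exists H, (perm f_inj), (fun x => tag x); split; last first.
  move=> i; rewrite -[RHS]card_ord -cardsT.
  have tI : injective (fun a : 'I_(m i) => Tagged (fun i => 'I_(m i)) a).
    by move=> a b /eqP; rewrite -tag_eqE /tag_eq /= eqxx tagged_asE => /eqP.
  rewrite -[RHS](card_imset _ tI).
  apply: eq_card => -[j a]; rewrite inE; apply/eqP/imsetP => /= [ji|[b _ /(congr1 tag)] //].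
  by case: i / ji {tI}; exists a.
have step (i : 'I_n) (z : 'I_(m i)) k (kz : k < m i) : z = 0 :> nat ->
    (perm f_inj ^+ k)%g (Tagged (fun i => 'I_(m i)) z)
      = Tagged (fun i => 'I_(m i)) (Ordinal kz).
  move=> z0; elim: k kz => [|k IH] kz.
    by rewrite expg0 perm1; congr Tagged; apply: val_inj.
  rewrite expgSr permM (IH (ltnW kz)) permE /f /=; congr Tagged; apply: val_inj => /=.
  by rewrite modn_small.
have to0 (i : 'I_n) (a : 'I_(m i)) (mi : 0 < m i) :
    porbit (perm f_inj) (Tagged (fun i => 'I_(m i)) a)
    = porbit (perm f_inj) (Tagged (fun i => 'I_(m i)) (Ordinal mi)).
  apply/eqP; rewrite eq_porbit_mem; apply/porbitP; exists a.
  by rewrite (step _ _ _ (ltn_ord a)) //; congr Tagged; apply: val_inj.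
apply/vertex_cyclesP => x y; apply/eqP/porbitP => [|[k ->]]; last first.
  by rewrite permX; elim: k => //= k ->; rewrite permE.
case: x y => [i a] [j b] /= ij; case: j / ij b => b.
have mi : 0 < m i by apply: leq_ltn_trans (ltn_ord a).
by apply/porbitP; rewrite -eq_porbit_mem (to0 _ a mi) (to0 _ b mi).
Qed.

(** By [catalan_natE] the truncation does not change the value for nonempty mu.
    Natural numbers have an image in a field of any characteristic. *)
Definition catalan_nat (g : int) (mu : seq nat) : nat := Num.truncn (catalan g mu).

Lemma catalan_natE (g : int) (mu : seq nat) :
  mu != [::] -> catalan g mu = ((catalan_nat g mu)%:R)%R.
Proof.
move=> mu_nil; suff [k kE] : exists k, catalan g mu = (k%:R)%R.
  by rewrite /catalan_nat kE Num.Theory.natrK.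
case: g => [g|g]; last by exists 0.
have [H [r [w [wr cw]]]] := vertex_cycles_exist (fun i : 'I_(size mu) => nth 0 mu i).
have [mu0|mu0] := boolP (0 \in mu).
  rewrite /catalan mu0; case: (_ && _); first by exists 1.
  by exists 0.
have lab : labelled_by setT r setT w (enum 'I_(size mu)).
  split; rewrite ?enum_uniq ?stableT ?subxx //.
  - by move=> x _; rewrite mem_enum.
  - move=> i _; have : 0 < #|[set x | w x == i]|.
      by rewrite cw lt0n; apply: contraNneq mu0 => <-; apply: mem_nth.
    by case/card_gt0P => x; rewrite inE => /eqP; exists x; rewrite ?inE.
  by move=> x y _ _; apply: (elimT (vertex_cyclesP _ _) wr).
have := catalanE g lab; set mu' := map _ _; suff <- : mu = mu'.
  move=> ->; first by exists #|maps setT r setT g|.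
  rewrite -size_eq0 size_enum_ord size_eq0; exact: mu_nil.
rewrite -[LHS](mkseq_nth 0) /mkseq -val_enum_ord -map_comp /mu'.
apply: eq_map => i /=; rewrite -cw; apply: eq_card => x; rewrite !inE.
by [].
Qed.

Lemma card_maps_catalan (T : finType) (L : eqType) (X : {set T}) (r : {perm T})
    (D : {set T}) (vt : T -> L) (ts : seq L) (g : nat) (mu : seq nat) :
    labelled_by X r D vt ts -> ts != [::] ->
    mu = [seq #|[set x in D | vt x == t]| | t <- ts] ->
  catalan_nat (Posz g) mu = #|maps X r D g|.
Proof. by move=> lab ts0 ->; rewrite /catalan_nat (catalanE g lab ts0) Num.Theory.natrK. Qed.

(** * Transpositions and cycles *)

Lemma tperm_mulK (H : finType) (s : {perm H}) (x y : H) :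
  (tperm x y * (tperm x y * s))%g = s.
Proof. by rewrite mulgA tperm2 mul1g. Qed.

Lemma stable_tperm_mul (H : finType) (s : {perm H}) (x y : H) (Y : {set H}) :
  (x \in Y) = (y \in Y) -> stable (tperm x y * s)%g Y = stable s Y.
Proof. by move=> xyY; apply: stable_mulKl; rewrite stable_tperm xyY. Qed.

Lemma porbit_tperm_out (H : finType) (s : {perm H}) (x y z : H) :
    z \notin porbit s x -> z \notin porbit s y ->
  porbit (tperm x y * s)%g z = porbit s z.
Proof.
move=> zx zy; apply/esym/(porbit_agree (stable_porbit s z)); last exact: porbit_id.
move=> u uz; rewrite permM tpermD //; [apply: contraNneq zx|apply: contraNneq zy] => ->;
  by rewrite porbit_sym.
Qed.

Lemma porbit_tpermU (H : finType) (s : {perm H}) (x y : H) :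
    x \in porbit s y ->
  porbit s y = porbit (tperm x y * s)%g x :|: porbit (tperm x y * s)%g y.
Proof.
set s' := (tperm x y * s)%g => xy.
have yy := porbit_id s y; have xx' := porbit_id s' x; have yy' := porbit_id s' y.
have s's : stable s' (porbit s y) by rewrite stable_tperm_mul ?xy ?yy // stable_porbit.
apply/eqP; rewrite eqEsubset subUset (porbit_sub s's xy) (porbit_sub s's yy) /= andbT.
apply: porbit_sub; last by rewrite inE yy' orbT.
rewrite -(tperm_mulK s x y) stable_tperm_mul ?inE ?xx' ?yy' ?orbT //.
by apply: stableU; apply: stable_porbit.
Qed.

Lemma mem_porbit_perm (H : finType) (s : {perm H}) (x : H) : s x \in porbit s x.
Proof. by rewrite -{1}[s]expg1 mem_porbit. Qed.

(** The transposition of x and y cuts the cycle of x into two arcs; the one that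
    ends at y consists of the points s x, ..., y. *)
Lemma card_porbit_arc (H : finType) (s : {perm H}) (x : H) (b : nat) :
    b.+1 < #|porbit s x| -> let y := (s ^+ b.+1)%g x in
  #|porbit (tperm x y * s)%g y| = b.+1.
Proof.
move=> bm y; set s' := (tperm x y * s)%g.
have neq i j : i < #|porbit s x| -> j < #|porbit s x| -> i != j ->
    (s ^+ i)%g x != (s ^+ j)%g x.
  by move=> im jm ij; rewrite expg_porbit !modn_small.
have it i : 0 < i <= b.+1 -> (s' ^+ i)%g y = (s ^+ i)%g x.
  elim: i => // -[_ _|i IH /andP[_ ib]]; first by rewrite !expg1 permM tpermR.
  rewrite expgSr permM IH /=; last exact: ltnW.
  rewrite [in RHS]expgSr !permM tpermD //.
    rewrite -{1}[x]perm1 -(expg0 s); apply: neq => //; first exact: leq_ltn_trans bm.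
    exact: ltn_trans bm.
  by apply: neq => //; [apply: ltn_trans bm | rewrite neq_ltn ib orbT].
set c := #|porbit s' y|; have c0 : 0 < c by rewrite lt0n card_porbit_neq0.
have cb : c %| b.+1.
  have : (s' ^+ b.+1)%g y == (s' ^+ 0)%g y by rewrite it ?leqnn // expg0 perm1.
  by rewrite expg_porbit mod0n.
apply/eqP; rewrite eqn_leq dvdn_leq //= leqNgt; apply/negP => cb'.
have : (s' ^+ c)%g y == (s' ^+ 0)%g y by rewrite expg_porbit mod0n modnn.
rewrite it ?c0 ?(ltnW cb') // expg0 perm1; apply/negP; apply: neq => //; first exact: ltn_trans bm.
by rewrite neq_ltn cb'.
Qed.

(** * Vertex degrees after removing an edge *)

Lemma catalan_nat_restrict (T : finType) (L : eqType) (r : {perm T}) (D : {set T})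
    (vt : T -> L) (ts : seq L) (g : nat) :
    uniq ts -> ts != [::] ->
    (forall x y, (vt x == vt y) = (y \in porbit r x)) ->
    {in ts, forall t, exists x, vt x = t} ->
  catalan_nat (Posz g) [seq #|[set x in D | vt x == t]| | t <- ts]
  = #|maps [set z | vt z \in ts] r (D :&: [set z | vt z \in ts]) g|.
Proof.
move=> uts ts0 vr tsv; set X := [set z | _].
apply: (@card_maps_catalan _ _ _ _ _ vt ts) => //.
  split=> //.
  - split; last exact: subsetIr.
    apply/stableP => z; rewrite !inE; have /eqP -> // : vt (r z) == vt z.
    by rewrite eq_sym vr mem_porbit_perm.
  - by move=> x; rewrite inE.
  - by move=> t tts; have [x xt] := tsv t tts; exists x; rewrite ?inE ?xt.
apply/eq_in_map => t tts; apply: eq_card => z; rewrite !inE -andbA.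
by case: (vt z =P t) => [->|_]; rewrite ?tts ?andbF.
Qed.

Section RemoveEdge.
Context (H : finType) (n : nat) (r : {perm H}) (vt : H -> 'I_n.+1)
  (mu : 'I_n.+1 -> nat).
Hypotheses (mu_gt0 : forall i, 0 < mu i)
  (vr : forall x y, (vt x == vt y) = (y \in porbit r x))
  (cv : forall i, #|[set x | vt x == i]| = mu i).
Context (x y : H).
Hypotheses (x0 : vt x = ord0) (xy : x != y).
Local Notation r' := (tperm x y * r)%g.
Local Notation D' := ([set: H] :\ x :\ y).

Let surj i : exists x, vt x = i.
Proof. by have := mu_gt0 i; rewrite -cv => /card_gt0P[z]; rewrite inE => /eqP; exists z. Qed.

Let degE (m : H -> bool) : #|[set z in D' | m z]| = #|[set z | m z] :\ x :\ y|.
Proof. by apply: eq_card => z; rewrite !inE andbT -!andbA. Qed.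

Let degN i : i != vt x -> i != vt y -> #|[set z in D' | vt z == i]| = mu i.
Proof.
move=> ix iy; rewrite degE -cv; apply: eq_card => z; rewrite !inE.
case: (vt z =P i) => [zi|_]; last by rewrite !andbF.
by rewrite !andbT; apply/andP; split; [apply: contraNneq iy|apply: contraNneq ix] => <-;
   rewrite zi.
Qed.

(** The merged vertex gets the label of x; it loses the two half-edges of the
    contracted edge. *)
Lemma catalan_nat_merge (g : nat) (j : 'I_n.+1) : vt y = j -> j != ord0 ->
  catalan_nat (Posz g) ((mu ord0 + mu j - 2) :: [seq mu i | i in [set~ ord0] :\ j])
  = #|maps setT r' D' g|.
Proof.
move=> yj j0; have yx : y \notin porbit r x by rewrite -vr x0 yj eq_sym.
have yx' : y \in porbit r' x by rewrite porbit_sym porbit_tperm_merge // porbit_sym.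
have Z : porbit r' x = porbit r x :|: porbit r y.
  have xy' : x \in porbit r' y by rewrite porbit_sym.
  have := porbit_tpermU xy'; rewrite tperm_mulK => <-.
  by apply/eqP; rewrite eq_porbit_mem.
pose vt' z := if vt z == j then ord0 else vt z.
have inZ z : (z \in porbit r' x) = (vt' z == ord0).
  rewrite Z inE -!vr x0 yj /vt' ![_ == vt z]eq_sym.
  by case: (vt z =P j) => _; rewrite ?eqxx ?orbT ?orbF.
apply: (@card_maps_catalan _ _ _ _ _ vt' (ord0 :: enum ([set~ ord0] :\ j))) => //.
  split=> [|//|z _|i|a b _ _].
  - by rewrite /= enum_uniq mem_enum !inE eqxx andbF.
  - by rewrite stableT subsetT.
  - rewrite /vt' inE mem_enum !inE; case: (vt z =P j) => [_|/eqP zj]; first by rewrite eqxx.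
    by rewrite zj orbN.
  - rewrite inE mem_enum !inE => /orP[/eqP->|/andP[ij i0]].
      by exists x; rewrite ?inE // /vt' x0; case: eqP.
    by have [z zi] := surj i; exists z; rewrite ?inE // /vt' zi (negPf ij).
  have [aZ|aZ] := boolP (a \in porbit r' x).
    have -> : porbit r' a = porbit r' x by apply/eqP; rewrite eq_porbit_mem.
    by rewrite inZ eq_sym; move: aZ; rewrite inZ => /eqP->.
  have := aZ; rewrite Z inE negb_or => /andP[ax ay].
  rewrite porbit_tperm_out // -vr /vt'; move: ax ay; rewrite -!vr x0 yj.
  case: (vt a =P j) => [->|aj]; first by rewrite eqxx.
  move=> a0 _; case: (vt b =P j) => [->|//].
  by rewrite eq_sym (negPf a0); apply/esym/eqP.
rewrite /=; congr (_ :: _).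
  rewrite (degE (fun z => vt' z == ord0)).
  have -> : [set z | vt' z == ord0] = [set z | vt z == ord0] :|: [set z | vt z == j].
    apply/setP => z; rewrite !inE /vt'; case: (vt z =P j) => [->|_]; rewrite ?eqxx ?orbT ?orbF //.
  have cU : #|[set z | vt z == ord0] :|: [set z | vt z == j]| = mu ord0 + mu j.
    rewrite cardsU !cv (_ : _ :&: _ = set0) ?cards0 ?subn0 //.
    apply/setP => z; rewrite !inE; apply/negP => /andP[/eqP->]; rewrite eq_sym.
    exact/negP.
  move: cU; set Z0 := _ :|: _ => cU.
  have := cardsD1 y (Z0 :\ x); have := cardsD1 x Z0.
  by rewrite cU !inE x0 yj !eqxx [y == x]eq_sym xy orbT /= => -> ->; rewrite addnA addKn.
apply/eq_in_map => i; rewrite mem_enum !inE => /andP[ij i0].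
rewrite -degN ?x0 ?yj //; apply: eq_card => z; rewrite !inE; congr (_ && _); rewrite /vt'.
case: (vt z =P j) => [->|//]; rewrite [LHS]eq_sym (negPf ij) eq_sym; apply/esym; exact: negPf.
Qed.

Hypotheses (y0 : vt y = ord0).
Let yx : x \in porbit r y. Proof. by rewrite -vr x0 y0. Qed.
Local Notation P := (porbit r' x).
Local Notation Q := (porbit r' y).
Let PQ : y \notin P.
Proof. by rewrite porbit_sym porbit_tperm_merge // negbK. Qed.
Let PUQ z : (z \in P) || (z \in Q) = (vt z == ord0).
Proof.
have /setP/(_ z) := porbit_tpermU yx.
by rewrite inE -vr y0 eq_sym.
Qed.
Let disjPQ z : z \in Q -> z \notin P.
Proof.
move=> zQ; apply: contraNN PQ => zP.
have -> : P = Q; last exact: porbit_id.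
by transitivity (porbit r' z); apply/eqP; rewrite ?[P == _]eq_sym eq_porbit_mem.
Qed.

(** The two parts of the split vertex are told apart by the label None for the
    part of x, while the part of y keeps the old label Some ord0. *)
Definition split_label z : option 'I_n.+1 := if z \in P then None else Some (vt z).
Local Notation vt2 := split_label.

Let vt2_some z i : (vt2 z == Some i) = (vt z == i) && (z \notin P).
Proof. by rewrite /split_label; case: (z \in P); rewrite ?andbF ?andbT. Qed.

Let vt2_none z : (vt2 z == None) = (z \in P).
Proof. by rewrite /split_label; case: (z \in P). Qed.

Let vt2_0 z : (vt2 z == Some ord0) = (z \in Q).
Proof.
rewrite vt2_some -PUQ; have [zP|zP] := boolP (z \in P); last by rewrite andbT.
by apply/esym; apply: contraTF zP; apply: disjPQ.
Qed.

Let vt2_other z i : i != ord0 -> (vt2 z == Some i) = (vt z == i).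
Proof.
move=> i0; rewrite vt2_some; case: (vt z =P i) => //= zi.
by apply: contraNN i0 => zP; rewrite -zi -PUQ zP.
Qed.

Let vr2 a b : (vt2 a == vt2 b) = (b \in porbit r' a).
Proof.
have [aP|aP] := boolP (a \in P).
  have -> : porbit r' a = P by apply/eqP; rewrite eq_porbit_mem.
  by rewrite -vt2_none eq_sym; congr (_ == _); apply/eqP; rewrite vt2_none.
have [aQ|aQ] := boolP (a \in Q).
  have -> : porbit r' a = Q by apply/eqP; rewrite eq_porbit_mem.
  by rewrite -vt2_0 eq_sym; congr (_ == _); apply/eqP; rewrite vt2_0.
have a0 : vt a != ord0 by rewrite -PUQ negb_or aP.
have ra : porbit r' a = porbit r a.
  by apply: porbit_tperm_out; rewrite -vr ?x0 ?y0 eq_sym.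
have -> : vt2 a = Some (vt a) by apply/eqP; rewrite vt2_some eqxx aP.
by rewrite ra -vr eq_sym vt2_other // eq_sym.
Qed.

Let hit t : exists z, vt2 z = t.
Proof.
case: t => [i|]; last by exists x; apply/eqP; rewrite vt2_none porbit_id.
have [->|i0] := eqVneq i ord0; first by exists y; apply/eqP; rewrite vt2_0 porbit_id.
by have [z zi] := surj i; exists z; apply/eqP; rewrite vt2_other // zi.
Qed.

Let deg_none : #|[set z in D' | vt2 z == None]| = #|P|.-1.
Proof.
rewrite (degE (fun z => vt2 z == None)) [#|P|](cardsD1 x) porbit_id add1n /=.
apply: eq_card => z; rewrite !inE vt2_none; case: (eqVneq z y) => //= ->.
by rewrite (negPf PQ) andbF.
Qed.

Let deg_some0 : #|[set z in D' | vt2 z == Some ord0]| = #|Q|.-1.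
Proof.
rewrite (degE (fun z => vt2 z == Some ord0)) [#|Q|](cardsD1 y) porbit_id add1n /=.
apply: eq_card => z; rewrite !inE vt2_0; case: (eqVneq z x) => //= ->.
by rewrite (contraTF (@disjPQ x)) ?andbF // porbit_id.
Qed.

Let deg_some (I : {set 'I_n.+1}) : I \subset [set~ ord0] ->
  [seq #|[set z in D' | vt2 z == Some i]| | i <- enum I] = [seq mu i | i in I].
Proof.
move=> I0; apply/eq_in_map => i; rewrite mem_enum => /(subsetP I0); rewrite !inE => i0.
rewrite -degN ?x0 ?y0 //; apply: eq_card => z; rewrite !inE.
by rewrite vt2_other.
Qed.

Lemma catalan_nat_split (g : nat) :
  catalan_nat (Posz g) [:: #|P|.-1, #|Q|.-1 & [seq mu i | i in [set~ ord0]]]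
  = #|maps setT r' D' g|.
Proof.
pose ts := [:: None, Some ord0 & [seq Some i | i <- enum [set~ (ord0 : 'I_n.+1)]]].
have uts : uniq ts.
  rewrite /= inE /=; apply/and3P; split.
  - by apply/mapP => -[].
  - by rewrite mem_map ?mem_enum ?inE ?eqxx // => a b [].
  by rewrite map_inj_uniq ?enum_uniq // => a b [].
have tsE t : t \in ts.
  case: t => [i|]; rewrite !inE ?eqxx //=; have [->//|i0] := eqVneq i ord0.
  apply/orP; right; apply/mapP; exists i => //.
  by rewrite mem_enum !inE.
have := @catalan_nat_restrict _ _ r' D' vt2 ts g uts isT vr2 (fun t _ => hit t).
have -> : [set z | vt2 z \in ts] = setT by apply/setP => z; rewrite !inE; exact: tsE.
rewrite setIT /= deg_none deg_some0 -map_comp => <-; congr (catalan_nat _ [:: _, _ & _]).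
by rewrite -deg_some.
Qed.

Definition component_over (I : {set 'I_n.+1}) : {set H} :=
  [set z | vt2 z \in None :: [seq Some i | i <- enum I]].
Local Notation Yof := component_over.

Let YofE (I : {set 'I_n.+1}) z : (z \in Yof I) = if vt2 z is Some i then i \in I else true.
Proof.
rewrite !inE; case: (vt2 z) => [i|//] /=.
by rewrite mem_map ?mem_enum // => a b [].
Qed.

Let YofC (I : {set 'I_n.+1}) z : I \subset [set~ ord0] ->
  (z \in [set: H] :\: Yof I)
  = (vt2 z \in Some ord0 :: [seq Some i | i <- enum ([set~ ord0] :\: I)]).
Proof.
move=> I0; rewrite in_setD in_setT andbT YofE inE; case: (vt2 z) => [i|] /=.
  rewrite mem_map ?mem_enum => [|a b []//]; rewrite !inE; have [->|i0] := eqVneq i ord0.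
    by rewrite eqxx; apply/negP => /(subsetP I0); rewrite !inE eqxx.
  by rewrite andbT; case: eqP => // -[/eqP]; rewrite (negPf i0).
by apply/esym/mapP => -[].
Qed.

Lemma catalan_nat_inside (g : nat) (I : {set 'I_n.+1}) : I \subset [set~ ord0] ->
  catalan_nat (Posz g) (#|P|.-1 :: [seq mu i | i in I])
  = #|maps (Yof I) r' (D' :&: Yof I) g|.
Proof.
move=> I0; rewrite -(deg_some I0) -deg_none.
rewrite (map_comp (fun t => #|[set z in D' | vt2 z == t]|) Some).
apply: (@catalan_nat_restrict _ _ r' D' vt2 (None :: [seq Some i | i <- enum I])) => //.
rewrite /= map_inj_uniq ?enum_uniq ?andbT; last by move=> a b [].
by apply/mapP => -[].
Qed.

Lemma catalan_nat_outside (g : nat) (I : {set 'I_n.+1}) : I \subset [set~ ord0] ->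
  catalan_nat (Posz g) (#|Q|.-1 :: [seq mu i | i in [set~ ord0] :\: I])
  = #|maps ([set: H] :\: Yof I) r' (D' :\: Yof I) g|.
Proof.
move=> I0; rewrite -deg_some ?subsetDl // -deg_some0.
rewrite (map_comp (fun t => #|[set z in D' | vt2 z == t]|) Some).
pose ts := Some ord0 :: [seq Some i | i <- enum ([set~ (ord0 : 'I_n.+1)] :\: I)].
have -> : [set: H] :\: Yof I = [set z | vt2 z \in ts].
  by apply/setP => z; rewrite (YofC z I0) [RHS]inE.
have -> : D' :\: Yof I = D' :&: [set z | vt2 z \in ts].
  apply/setP => z; have := YofC z I0; rewrite in_setD in_setT andbT => E.
  by rewrite in_setD in_setI E andbC [in RHS]inE.
apply: (@catalan_nat_restrict _ _ r' D' vt2 ts) => //.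
rewrite /= map_inj_uniq ?enum_uniq ?andbT; last by move=> a b [].
by rewrite mem_map ?mem_enum ?inE ?eqxx ?andbF // => a b [].
Qed.

(** A component is determined by the vertices that it contains. It contains the
    part of x of the split vertex and does not contain the part of y, so that the
    other vertices of it form an arbitrary subset of the complement of ord0. *)
Lemma sum_cuts (F : {set H} -> nat) :
  \sum_(Y in cuts setT r' x y) F Y
  = \sum_(I : {set 'I_n.+1} | I \subset [set~ ord0]) F (Yof I).
Proof.
pose Iof (Y : {set H}) : {set 'I_n.+1} := [set i | [exists z in Y, vt2 z == Some i]].
have YofK Y : Y \in cuts setT r' x y -> Yof (Iof Y) = Y.
  rewrite inE => /and4P[_ rY xY yY]; apply/setP => z; rewrite YofE.
  case E : (vt2 z) => [i|]; last first.
    by apply/esym; rewrite (porbit_stable rY (_ : z \in porbit r' x)) // -vt2_none E.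
  rewrite inE; apply/exists_inP/idP => [[z' z'Y]|zY]; last by exists z; rewrite ?E.
  by rewrite -E vr2 => zz'; rewrite (porbit_stable rY zz').
rewrite (reindex_onto Yof Iof) //=; last first.
apply: eq_bigl => I; apply/andP/idP => [[]|I0].
  rewrite inE => /and4P[_ rY xY yY] /eqP <-; apply/subsetP => i.
  rewrite !inE => /exists_inP[z zY zi]; apply: contraNneq yY => i0.
  by rewrite i0 vt2_0 in zi; rewrite -(porbit_stable rY zi).
split.
  rewrite inE subsetT !YofE /=; apply/and3P; split=> //.
  - apply/stableP => z; rewrite !YofE; have /eqP -> // : vt2 (r' z) == vt2 z.
    by rewrite eq_sym vr2 mem_porbit_perm.
  - by have /eqP -> : vt2 x == None by rewrite vt2_none porbit_id.
  have /eqP -> : vt2 y == Some ord0 by rewrite vt2_0 porbit_id.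
  by apply/negP => /(subsetP I0); rewrite !inE eqxx.
apply/eqP/setP => i; rewrite inE; apply/exists_inP/idP => [[z + /eqP zi]|iI].
  by rewrite YofE zi.
by have [z zi] := hit (Some i); exists z; rewrite ?YofE zi.
Qed.

End RemoveEdge.

(** * The recursion for Catalan numbers *)

(** The other points of the cycle of x are indexed by the number b of points
    strictly between x and them, and the number a of points strictly between them
    and x, along the cycle. *)
Lemma sum_arcs (H : finType) (r : {perm H}) (x : H) (F : H -> nat) :
  \sum_(y in porbit r x :\ x) F y =
  \sum_(a < #|porbit r x|) \sum_(b < #|porbit r x| | a + b + 2 == #|porbit r x|)
     F ((r ^+ b.+1)%g x).
Proof.
set m := #|porbit r x|.
rewrite (exchange_big_dep xpredT) //=.
pose B := [set b : 'I_m | b.+1 < m].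
have f_inj : {in B &, injective (fun b : 'I_m => (r ^+ b.+1)%g x)}.
  move=> b c; rewrite !inE => bm cm /eqP; rewrite expg_porbit -/m !modn_small //.
  by rewrite eqSS => /eqP/val_inj.
have -> : porbit r x :\ x = [set (r ^+ (b : 'I_m).+1)%g x | b in B].
  apply/setP => y; rewrite !inE; apply/andP/imsetP => [[yx]|[b + ->]].
    rewrite porbit_traject => /trajectP[[|b] bm yE]; first by rewrite yE eqxx in yx.
    by exists (Ordinal (ltnW bm)); rewrite ?inE //= permX.
  rewrite inE => bm; rewrite mem_porbit; split=> //.
  by rewrite -{2}[x]perm1 -(expg0 r) expg_porbit -/m !modn_small // (ltn_trans _ bm).
rewrite big_imset //= [RHS](bigID [in B]) /= [X in _ = _ + X]big1 ?addn0 => [|b]; last first.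
  rewrite inE -leqNgt => bm; rewrite big1 // => a /eqP E; have := ltn_ord b; lia.
apply: eq_bigr => b; rewrite inE => bm.
have am : m - b - 2 < m by have := ltn_ord b; lia.
rewrite (big_pred1 (Ordinal am)) // => a /=.
rewrite -val_eqE /=; apply/eqP/eqP; have := ltn_ord b; have := ltn_ord a; lia.
Qed.

(** The arrow of the first vertex selects a half-edge x; the terms correspond to
    the position of its other half y. If y is at another vertex j, the edge is
    contracted and there are mu j possible y. If y is at the same vertex, the loop
    is removed and splits the vertex into parts with alpha and beta half-edges,
    leaving a connected or a disconnected graph. *)
Theorem catalan_nat_rec (g n : nat) (mu : 'I_n.+1 -> nat) :
    (forall i, 0 < mu i) ->
  catalan_nat (Posz g) [seq mu i | i : 'I_n.+1] =
    \sum_(j : 'I_n.+1 | j != ord0)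
       mu j * catalan_nat (Posz g)
         ((mu ord0 + mu j - 2) :: [seq mu i | i in [set~ ord0] :\ j])
  + \sum_(alpha < mu ord0) \sum_(beta < mu ord0 | alpha + beta + 2 == mu ord0)
       (if g is g'.+1 then catalan_nat (Posz g')
         [:: val alpha, val beta & [seq mu i | i in [set~ ord0]]] else 0)
  + \sum_(alpha < mu ord0) \sum_(beta < mu ord0 | alpha + beta + 2 == mu ord0)
    \sum_(g1 < g.+1) \sum_(g2 < g.+1 | g1 + g2 == g)
    \sum_(I : {set 'I_n.+1} | I \subset [set~ ord0])
       catalan_nat (Posz g1) (val alpha :: [seq mu i | i in I])
       * catalan_nat (Posz g2) (val beta :: [seq mu i | i in [set~ ord0] :\: I]).
Proof.
move=> mu_gt0; have [H [r [vt [/vertex_cyclesP vr cv]]]] := vertex_cycles_exist mu.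
have [x x0] : exists x, vt x = ord0.
  by have := mu_gt0 ord0; rewrite -cv => /card_gt0P[z]; rewrite inE => /eqP; exists z.
have -> : catalan_nat (Posz g) [seq mu i | i : 'I_n.+1] = #|maps setT r setT g|.
  have := @catalan_nat_restrict _ _ r setT vt (enum 'I_n.+1) g (enum_uniq _) _ vr.
  have -> : [set z | vt z \in enum 'I_n.+1] = setT.
    by apply/setP => z; rewrite !inE mem_enum.
  rewrite setIT => <-.
  - congr catalan_nat; apply: eq_map => i; rewrite -cv.
    by apply: eq_card => z; rewrite !inE.
  - by rewrite -size_eq0 size_enum_ord.
  move=> i _; have := mu_gt0 i; rewrite -cv => /card_gt0P[z]; rewrite inE => /eqP.
  by exists z.
have cP : #|porbit r x| = mu ord0.
  by rewrite -cv; apply: eq_card => z; rewrite !inE -vr x0 eq_sym.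
rewrite (maps_sum_partner _ _ _ (in_setT x)).
rewrite (bigID (fun y => vt y != ord0)) /= -addnA; congr (_ + _).
  rewrite (partition_big vt (fun j => j != ord0)) /= => [|y /andP[]//].
  apply: eq_bigr => j j0; rewrite -cv -sum_nat_const.
  apply: eq_big => [y|y /andP[/andP[yx y0] /eqP yj]].
    rewrite !inE andbT; case: (vt y =P j) => [yj|_]; rewrite ?andbF ?andbT //.
    by rewrite yj j0 andbT; apply: contraNneq j0 => yx; rewrite -yj yx x0.
  have xy : x != y by apply: contraNneq y0 => <-; rewrite x0.
  rewrite card_maps_partner ?inE // edge_removed_maps_merge ?inE ?subsetT ?stableT //.
    by rewrite -(catalan_nat_merge mu_gt0 vr cv x0 xy g yj j0) cv.
  by rewrite -vr x0 eq_sym.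
rewrite (eq_bigl (fun y => y \in porbit r x :\ x)) => [|y]; last first.
  by rewrite !inE andbT negbK -vr x0 [ord0 == _]eq_sym.
rewrite sum_arcs cP -big_split; apply: eq_bigr => a _ /=.
rewrite -big_split; apply: eq_bigr => b /eqP abm /=.
set y := (r ^+ b.+1)%g x.
have bm : b.+1 < #|porbit r x| by rewrite cP; move: abm; clear; lia.
have yx : y \in porbit r x by apply: mem_porbit.
have y0 : vt y = ord0 by apply/eqP; rewrite -x0 eq_sym vr.
have xy : x != y.
  by rewrite -{1}[x]perm1 -(expg0 r) expg_porbit !modn_small // (ltn_trans _ bm).
have cQ := card_porbit_arc bm; rewrite /= -/y in cQ.
have cPP : #|porbit (tperm x y * r)%g x| = a.+1.
  have xy' : x \in porbit r y by rewrite porbit_sym.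
  have := porbit_tpermU xy' => /(congr1 (fun A : {set H} => #|A|)).
  rewrite cardsU (_ : _ :&: _ = set0) ?cards0 ?subn0 ?cQ.
    have -> : porbit r y = porbit r x by apply/eqP; rewrite eq_porbit_mem.
    rewrite cP; move: abm; clear; move: #|_| => k; lia.
  apply/setP => z; rewrite !inE; apply/negP => /andP[zx zy].
  move: (porbit_tperm_merge r xy); rewrite xy' /= => /negP; apply.
  by rewrite -eq_porbit_mem; apply/eqP; transitivity (porbit (tperm x y * r)%g z);
     apply/eqP; rewrite ?[porbit _ x == _]eq_sym eq_porbit_mem.
rewrite card_maps_partner ?inE //.
rewrite -(cardsID [set o | transitive_on setT (tperm x y * r)%g o]).
have rT := stableT r; have DT := subxx [set: H].
congr (_ + _).
  have := edge_removed_connected g rT DT (in_setT x) (in_setT y) xy yx.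
  set A := [set o in _ | _] => cA; transitivity #|A|.
    by apply: eq_card => o; rewrite !in_set.
  rewrite cA; case: (g) => // g'.
  by rewrite -(catalan_nat_split mu_gt0 vr cv x0 xy y0) cPP cQ.
have := edge_removed_disconnected g rT DT (in_setT x) (in_setT y) xy yx.
set A := [set o in _ | _] => cA; transitivity #|A|.
  by apply: eq_card => o; rewrite !in_set andbC.
rewrite cA; apply: eq_bigr => g1 _; apply: eq_bigr => g2 _.
rewrite (sum_cuts mu_gt0 vr cv x0 xy y0).
apply: eq_bigr => I I0.
have := catalan_nat_inside mu_gt0 vr cv x0 xy y0 g1 I0.
have := catalan_nat_outside mu_gt0 vr cv x0 xy y0 g2 I0.
by rewrite cPP cQ => -> ->.
Qed.

(** * Frobenius algebras *)

Import GRing.Theory.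
Local Open Scope ring_scope.

Section Frobenius.
Context (K : fieldType) (A : falgType K).
Context (eta : frobenius_form A) (s : nat) (e : s.-tuple A).
Hypothesis (e_basis : basis_of {:A} e).
Local Notation gram := (\matrix_(i < s, j < s) eta e`_i e`_j).
Local Notation ig := (inv_gram eta e).

Lemma basis_sum (u : A) : exists c : 'I_s -> K, u = \sum_i c i *: e`_i.
Proof.
exists (fun i => coord e i u); apply: coord_span.
by case/andP: e_basis => /eqP -> _; apply: memvf.
Qed.

Lemma eta_basis_inj (u w : A) : (forall j : 'I_s, eta u e`_j = eta w e`_j) -> u = w.
Proof.
move=> uw; apply/eqP; rewrite -subr_eq0; apply/eqP/form_nondegenerate => z.
have [c ->] := basis_sum z; rewrite linear_sumr big1 // => i _.
rewrite linearZr_LR linearBl /=; have /eqP := uw i; rewrite -subr_eq0 => /eqP uwi.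
by transitivity (c i * 0); [congr (_ * _); exact: uwi | rewrite mulr0].
Qed.

Lemma gram_unit : gram \in unitmx.
Proof.
rewrite -row_free_unit; apply: inj_row_free => c cg.
have c0 : \sum_i c 0 i *: e`_i = 0.
  apply: eta_basis_inj => j; rewrite linear_sumlz linear0l.
  transitivity ((c *m gram) 0 j); last by rewrite cg mxE.
  rewrite mxE; apply: eq_bigr => i _; by rewrite linearZl_LR mxE.
have := basis_free e_basis; move/freeP => /(_ (fun i => c 0 i) c0) ci.
by apply/rowP => i; rewrite ci mxE.
Qed.

Lemma inv_gramC i j : ig i j = ig j i.
Proof.
have E : ig^T = ig.
  rewrite /inv_gram trmx_inv; congr invmx.
  by apply/matrixP => a b; rewrite !mxE form_sym.
by rewrite -{1}E mxE.
Qed.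

Lemma sum_inv_gram (i k : 'I_s) : \sum_j ig i j * eta e`_j e`_k = (i == k)%:R.
Proof.
transitivity ((invmx gram *m gram) i k); last by rewrite (mulVmx gram_unit) mxE.
by rewrite mxE; apply: eq_bigr => j _; rewrite !mxE.
Qed.

(** Both sides have the same pairing with every basis vector, and eta is
    nondegenerate. *)
Lemma dual_expansion (u : A) :
  \sum_(b < s) (\sum_(a < s) eta u e`_a * ig a b) *: e`_b = u.
Proof.
apply: eta_basis_inj => k; rewrite linear_sumlz.
transitivity (\sum_(b < s) \sum_(a < s) eta u e`_a * (ig a b * eta e`_b e`_k)).
  by apply: eq_bigr => b _; rewrite linearZl_LR /= mulr_suml; apply: eq_bigr => a _; rewrite mulrA.
rewrite exchange_big /= (bigD1 k) //= -mulr_sumr sum_inv_gram eqxx mulr1.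
rewrite big1 ?addr0 // => a ak; rewrite -mulr_sumr sum_inv_gram (negPf ak) mulr0 //.
Qed.

Lemma counit_mul (u v : A) : counit eta (u * v) = eta u v.
Proof. by rewrite /counit -form_mul mul1r. Qed.

Lemma dual_expansionC (w : A) :
  \sum_(k < s) (\sum_(a < s) ig k a * eta e`_a w) *: e`_k = w.
Proof.
rewrite -[RHS]dual_expansion; apply: eq_bigr => k _; congr (_ *: _).
by apply: eq_bigr => a _; rewrite inv_gramC form_sym mulrC.
Qed.

(** The values of counit (- * p) on the basis are the coordinates of p in the
    dual basis; hence the two sums over the bases rebuild p and q. *)
Lemma codual_counit (c d : K) (p q v : A) :
  codual eta e (fun x => c * counit eta (x * p)) (fun x => d * counit eta (x * q)) v
  = c * d * counit eta (v * p * q).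
Proof.
pose cp (w : A) (k : 'I_s) := \sum_(a < s) ig k a * eta e`_a w.
transitivity (\sum_(k < s) \sum_(l < s) c * d * (cp p k * (cp q l * eta (v * e`_k) e`_l))).
  apply: eq_bigr => k _; apply: eq_bigr => l _.
  have -> : c * d * (cp p k * (cp q l * eta (v * e`_k) e`_l))
          = c * d * eta (v * e`_k) e`_l * (cp p k * cp q l) by ring.
  rewrite /cp big_distrlr /= mulr_sumr; apply: eq_bigr => a _.
  rewrite mulr_sumr; apply: eq_bigr => b _.
  by rewrite !counit_mul /three_point; ring.
rewrite counit_mul -{2}(dual_expansionC p) -{2}(dual_expansionC q).
rewrite mulr_sumr linear_sumlz mulr_sumr; apply: eq_bigr => k _.
rewrite linear_sumr mulr_sumr; apply: eq_bigr => l _.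
by rewrite linearZr_LR -scalerAr linearZl_LR /=; congr (_ * _); rewrite mulrCA.
Qed.

(** Summing over one of the two pairs of dual indices rebuilds v * e_i. *)
Lemma mul_coproduct (v : A) :
  tensor_lift e (fun x y : A => x * y) (coproduct eta e v)
  = \sum_(i < s) \sum_(a < s) ig i a *: (e`_a * (v * e`_i)).
Proof.
rewrite /tensor_lift.
transitivity (\sum_(a < s) \sum_(b < s) \sum_(i < s)
   (ig i a *: (e`_a * ((\sum_(j < s) eta (v * e`_i) e`_j * ig j b) *: e`_b)))).
  apply: eq_bigr => a _; apply: eq_bigr => b _; rewrite mxE scaler_suml.
  apply: eq_bigr => i _; rewrite -scalerAr scalerA; congr (_ *: _).
  rewrite mulr_sumr; apply: eq_bigr => j _; rewrite /three_point.
  by rewrite mulrAC mulrC.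
under eq_bigr => a _ do rewrite exchange_big /=.
rewrite exchange_big /=; apply: eq_bigr => i _; apply: eq_bigr => a _.
by rewrite -scaler_sumr -mulr_sumr dual_expansion.
Qed.

Hypothesis (mulC : commutative (fun u v : A => u * v)).

(** Commutativity moves v in front of the double sum of [mul_coproduct], which
    for v = 1 is the Euler element. *)
Lemma mul_coproductE (v : A) :
  tensor_lift e (fun x y : A => x * y) (coproduct eta e v) = v * euler eta e.
Proof.
rewrite /euler !mul_coproduct mulr_sumr; apply: eq_bigr => i _.
rewrite mulr_sumr; apply: eq_bigr => a _.
by rewrite mul1r -scalerAr mulrA [e`_a * v]mulC -mulrA.
Qed.

Lemma tensor_lift_counit (c : K) (w v : A) :
  tensor_lift e (fun x y : A => c * counit eta (x * (y * w)) : K^o) (coproduct eta e v)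
  = c * counit eta (v * euler eta e * w).
Proof.
rewrite counit_mul -mul_coproductE /tensor_lift linear_sumlz mulr_sumr.
apply: eq_bigr => a _; rewrite linear_sumlz mulr_sumr; apply: eq_bigr => b _.
by rewrite linearZl_LR /= -counit_mul -mulrA [_ *: _]mulrCA.
Qed.

Lemma prod_image_setD (I : finType) (v : I -> A) (B C : {set I}) : C \subset B ->
  \prod_(x <- [seq v i | i in B]) x
  = (\prod_(x <- [seq v i | i in C]) x) * (\prod_(x <- [seq v i | i in B :\: C]) x).
Proof.
move=> CB; pose law := Monoid.isComLaw.Build A 1 *%R (@mulrA A) mulC (@mul1r A).
pose M : Monoid.com_law (1 : A) := HB.pack (@GRing.mul A) law.
have : \big[M/1]_(x <- [seq v i | i in B]) x
  = M (\big[M/1]_(x <- [seq v i | i in C]) x) (\big[M/1]_(x <- [seq v i | i in B :\: C]) x).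
  by rewrite !big_image (big_setID C) (setIidPr CB).
by [].
Qed.

End Frobenius.

Lemma twisted_catalan_nat (K : fieldType) (A : falgType K) (eta : frobenius_form A)
    (s : nat) (e : s.-tuple A) (g : nat) (mu : seq nat) (v : seq A) : mu != [::] ->
  twisted_catalan eta e (Posz g) mu v
  = (catalan_nat (Posz g) mu)%:R * tqft eta e g v.
Proof. by move=> mu0; rewrite /twisted_catalan catalan_natE // ratr_nat. Qed.

Lemma eq_tensor_lift (K : fieldType) (A : falgType K) (W : lmodType K)
    (s : nat) (e : s.-tuple A) (F G : A -> A -> W) (t : 'M[K]_s) :
  (forall x y, F x y = G x y) -> tensor_lift e F t = tensor_lift e G t.
Proof. by move=> FG; apply: eq_bigr => a _; apply: eq_bigr => b _; rewrite FG. Qed.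

Lemma eq_codual (K : fieldType) (A : falgType K) (eta : frobenius_form A)
    (s : nat) (e : s.-tuple A) (f f' h h' : A -> K) (v : A) :
  f =1 f' -> h =1 h' -> codual eta e f h v = codual eta e f' h' v.
Proof.
move=> ff hh; apply: eq_bigr => k _; apply: eq_bigr => l _.
by apply: eq_bigr => a _; apply: eq_bigr => b _; rewrite ff hh.
Qed.

(** * The twisted recursion *)

Theorem corollary4p2 (K : fieldType) (A : falgType K)
    (mulC : commutative (fun u v : A => u * v)) (eta : frobenius_form A)
    (s : nat) (e : s.-tuple A) (e_basis : basis_of {:A} e)
    (g n : nat) (mu : 'I_n.+1 -> nat) (v : 'I_n.+1 -> A)
    (mu_gt0 : forall i, (0 < mu i)%N) :
  twisted_catalan eta e g%:Z [seq mu i | i : 'I_n.+1] [seq v i | i : 'I_n.+1] =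
    \sum_(j : 'I_n.+1 | j != ord0)
       (mu j)%:R *
       twisted_catalan eta e g%:Z
         ((mu ord0 + mu j - 2)%N :: [seq mu i | i in [set~ ord0] :\ j])
         (v ord0 * v j :: [seq v i | i in [set~ ord0] :\ j])
  + \sum_(alpha < mu ord0) \sum_(beta < mu ord0 | (alpha + beta + 2 == mu ord0)%N)
       tensor_lift e
         (fun x y : A =>
            twisted_catalan eta e (g%:Z - 1)
              [:: val alpha, val beta & [seq mu i | i in [set~ ord0]]]
              [:: x, y & [seq v i | i in [set~ ord0]]] : K^o)
         (coproduct eta e (v ord0))
  + \sum_(alpha < mu ord0) \sum_(beta < mu ord0 | (alpha + beta + 2 == mu ord0)%N)
    \sum_(g1 < g.+1) \sum_(g2 < g.+1 | (g1 + g2 == g)%N)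
    \sum_(I : {set 'I_n.+1} | I \subset [set~ ord0])
       codual eta e
         (fun x : A =>
            twisted_catalan eta e (val g1)%:Z
              (val alpha :: [seq mu i | i in I])
              (x :: [seq v i | i in I]))
         (fun x : A =>
            twisted_catalan eta e (val g2)%:Z
              (val beta :: [seq mu i | i in [set~ ord0] :\: I])
              (x :: [seq v i | i in [set~ ord0] :\: I]))
         (v ord0).
Proof.
pose eul := euler eta e.
pose P (B : {set 'I_n.+1}) : A := \prod_(x <- [seq v i | i in B]) x.
pose Omega := counit eta (v ord0 * P [set~ ord0] * eul ^+ g).
have PD (B C : {set 'I_n.+1}) : C \subset B -> P B = P C * P (B :\: C) by apply: prod_image_setD.
have tqft_cons h x (B : {set 'I_n.+1}) : tqft eta e h (x :: [seq v i | i in B])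
    = counit eta (x * (P B * eul ^+ h)).
  by rewrite /tqft big_cons mulrA.
have tqft_all : tqft eta e g [seq v i | i : 'I_n.+1] = Omega.
  rewrite /tqft /Omega; congr (counit eta (_ * _)).
  have := PD setT [set ord0] (subsetT _).
  rewrite {2}/P /image_mem enum_set1 /= big_cons big_nil mulr1 setTD => <-.
  by rewrite /P /image_mem; congr (\prod_(x <- map v _) x); apply: eq_enum => i; rewrite in_setT.
rewrite twisted_catalan_nat ?tqft_all; last first.
  by rewrite -size_eq0 size_image card_ord.
rewrite (catalan_nat_rec g mu_gt0) !natrD !mulrDl; congr (_ + _ + _).
- rewrite natr_sum mulr_suml; apply: eq_bigr => j j0.
  rewrite twisted_catalan_nat // natrM -mulrA tqft_cons; congr (_ * (_ * _)).
  rewrite /Omega (PD [set~ ord0] [set j]) ?sub1set ?inE //.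
  by rewrite {1}/P /image_mem enum_set1 /= big_cons big_nil mulr1 !mulrA.
- rewrite natr_sum mulr_suml; apply: eq_bigr => a _.
  rewrite natr_sum mulr_suml; apply: eq_bigr => b _.
  case: (g) @Omega tqft_all => [|g'] Omega tqft_all.
    rewrite mul0r /tensor_lift big1 // => i _; rewrite big1 // => j _.
    by rewrite /= scaler0.
  have -> : (g'.+1%:Z - 1 = g'%:Z)%R by rewrite -addn1 PoszD addrK.
  rewrite (@eq_tensor_lift _ _ _ _ _ _ (fun x y : A =>
      (catalan_nat g' [:: val a, val b & [seq mu i | i in [set~ ord0]]])%:R
      * counit eta (x * (y * (P [set~ ord0] * eul ^+ g'))) : K^o)) => [|x y].
    rewrite tensor_lift_counit //; congr (_ * counit eta _).
    by rewrite exprS -!mulrA; congr (_ * _); rewrite mulrA [P _ * eul]mulC -mulrA.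
  by rewrite twisted_catalan_nat // /tqft !big_cons !mulrA.
- rewrite natr_sum mulr_suml; apply: eq_bigr => a _.
  rewrite natr_sum mulr_suml; apply: eq_bigr => b _.
  rewrite natr_sum mulr_suml; apply: eq_bigr => g1 _.
  rewrite natr_sum mulr_suml; apply: eq_bigr => g2 /eqP gE.
  rewrite natr_sum mulr_suml; apply: eq_bigr => I I0.
  rewrite (@eq_codual _ _ _ _ _ _
      (fun x => (catalan_nat g1 (val a :: [seq mu i | i in I]))%:R
                * counit eta (x * (P I * eul ^+ g1))) _
      (fun x => (catalan_nat g2 (val b :: [seq mu i | i in [set~ ord0] :\: I]))%:R
                * counit eta (x * (P ([set~ ord0] :\: I) * eul ^+ g2)))) => [|x|x];
    try by rewrite twisted_catalan_nat // tqft_cons.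
  rewrite codual_counit // natrM; congr (_ * counit eta _).
  have -> : eul ^+ g = eul ^+ g1 * eul ^+ g2 by rewrite -exprD gE.
  rewrite (PD _ I I0) -!mulrA; congr (_ * (_ * _)).
  by rewrite mulrA [P _ * eul ^+ g1]mulC -mulrA.
Qed.
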